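(* Let $(\boldsymbol S(t))_{t\ge 0}$ be a $k$-dimensional additive subordinator and, for $0\le t_1\le t_2$, let $\pi_{t_1,t_2}$ be the distribution on $\mathbb R^k_+$ of the increment $\boldsymbol S(t_2)-\boldsymbol S(t_1)$. Let $(T_{\boldsymbol s})_{\boldsymbol s\succeq \boldsymbol 0}$ be a $k$-parameter strongly continuous semigroup on $\mathfrak B_b(\mathbb R^d)$ associated to a $k$-parameter homogeneous Markov process $(\boldsymbol X(\boldsymbol s))_{\boldsymbol s\in\mathbb R^k_+}$ with values in $\mathbb R^d$, independent of $\boldsymbol S$, and let $\mu_{\boldsymbol s}(\boldsymbol x,d\boldsymbol y)$ be the law of $\boldsymbol X(\boldsymbol s)$ when starting from $\boldsymbol x\in\mathbb R^d$. For $0\le t_1\le t_2$ and $f\in\mathfrak B_b(\mathbb R^d)$ define $$T_{t_1,t_2}f(\boldsymbol x)=\int_{\mathbb R^k_+}T_{\boldsymbol s}f(\boldsymbol x)\,\pi_{t_1,t_2}(d\boldsymbol s).$$ Then the two-parameter family $(T_{t_1,t_2})_{t_1\le t_2}$ is a Markov evolution, and it is the Markov evolution associated to the subordinated process $$\boldsymbol Y(t)=\boldsymbol X(\boldsymbol S(t)),\qquad t\ge 0,$$ which is a time-inhomogeneous normal Markov process with transition probabilities $$p_{t_1,t_2}(\boldsymbol x,d\boldsymbol y)=\int_{\mathbb R^k_+}\mu_{\boldsymbol s}(\boldsymbol x,d\boldsymbol y)\,\pi_{t_1,t_2}(d\boldsymbol s).$$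
   Context: $\mathfrak B_b(\mathbb R^d)$ is the Banach space of bounded Borel functions $\mathbb R^d\to\mathbb R$ with the supremum norm $\|\cdot\|_\infty$. On $\mathbb R^k$, $\boldsymbol s\preceq\boldsymbol t$ means $s_j\le t_j$ for all $j$. A $k$-parameter filtration is a family $(\mathcal F_{\boldsymbol s})_{\boldsymbol s\in\mathbb R^k_+}$ of sub-$\sigma$-algebras with $\mathcal F_{\boldsymbol s}\subseteq\mathcal F_{\boldsymbol t}$ for $\boldsymbol s\preceq\boldsymbol t$; it is commuting (w.r.t. a probability $P$) if for all $\boldsymbol s,\boldsymbol t$ and every bounded $\mathcal F_{\boldsymbol t}$-measurable $Z$, $E[Z\mid\mathcal F_{\boldsymbol s}]=E[Z\mid\mathcal F_{\boldsymbol s\wedge\boldsymbol t}]$ a.s. (componentwise minimum). A $k$-parameter family $(T_{\boldsymbol s})_{\boldsymbol s\succeq\boldsymbol 0}$ of bounded linear operators on $\mathfrak B_b(\mathbb R^d)$ is a $k$-parameter semigroup if $T_{\boldsymbol 0}=\mathrm{Id}$ and $T_{\boldsymbol s+\boldsymbol t}=T_{\boldsymbol s}T_{\boldsymbol t}$. A $k$-parameter $\mathbb R^d$-valued process $(\boldsymbol X(\boldsymbol s))_{\boldsymbol s\in\mathbb R^k_+}$ is a homogeneous Markov process if there are a $k$-parameter filtration $(\mathcal F_{\boldsymbol s})$ and operators $(T_{\boldsymbol s})_{\boldsymbol s\succeq \boldsymbol 0}$ such that for every $\boldsymbol x\in\mathbb R^d$ there is a probability measure $\mathbb P_{\boldsymbol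 x}$ (expectation $\mathbb E_{\boldsymbol x}$) with: (a) $\boldsymbol X$ is adapted; (b) trajectories are $\mathbb P_{\boldsymbol x}$-a.s. càdlàg in the partial order $\preceq$; (c) each $\mathcal F_{\boldsymbol s}$ is $\mathbb P_{\boldsymbol x}$-complete and the filtration is commuting w.r.t. all $\mathbb P_{\boldsymbol x}$; (d) $\mathbb E_{\boldsymbol x}[f(\boldsymbol X(\boldsymbol s+\boldsymbol t))\mid\mathcal F_{\boldsymbol s}]=T_{\boldsymbol t}f(\boldsymbol X(\boldsymbol s))$ for all $f\in\mathfrak B_b(\mathbb R^d)$, $\boldsymbol s,\boldsymbol t\in\mathbb R^k_+$; (e) $\mathbb P_{\boldsymbol x}(\boldsymbol X(\boldsymbol 0)=\boldsymbol x)=1$. Then $T_{\boldsymbol s}f(\boldsymbol x)=\mathbb E_{\boldsymbol x}[f(\boldsymbol X(\boldsymbol s))]=\int f(\boldsymbol y)\mu_{\boldsymbol s}(\boldsymbol x,d\boldsymbol y)$ with $\mu_{\boldsymbol s}(\boldsymbol x,d\boldsymbol y)=\mathbb P_{\boldsymbol x}(\boldsymbol X(\boldsymbol s)\in d\boldsymbol y)$, and $(T_{\boldsymbol s})$ is the semigroup associated to $\boldsymbol X$. A $k$-dimensional additive subordinator is an $\mathbb R^k_+$-valued additive process (started at $\boldsymbol 0$, càdlàg, independent but not necessarily stationary increments, continuous in probability) that is increasing in each component. A family $(T_{t_1,t_2})_{0\le t_1\le t_2<\infty}$ is a Markov evolution if: (1) each $T_{t_1,t_2}$ is a linear operator on $\mathfrak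 B_b(\mathbb R^d)$; (2) $T_{t,t}=\mathrm{Id}$; (3) $T_{t_1,t_2}T_{t_2,t_3}=T_{t_1,t_3}$ for $t_1\le t_2\le t_3$; (4) $f\ge0\Rightarrow T_{t_1,t_2}f\ge 0$; (5) $\|T_{t_1,t_2}f\|_\infty\le\|f\|_\infty$; (6) $T_{t_1,t_2}1=1$. The family associated to a (one-parameter) Markov process $\boldsymbol Y$ is $T_{t_1,t_2}f(\boldsymbol x)=\mathbb E[f(\boldsymbol Y(t_2))\mid\boldsymbol Y(t_1)=\boldsymbol x]$; $\boldsymbol Y$ is normal if $T_{t_1,t_2}(\mathfrak B_b(\mathbb R^d))\subseteq\mathfrak B_b(\mathbb R^d)$. *)

(* Defs.v *)
(* MathComp / MathComp-Analysis. *)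
From HB Require Import structures.
From mathcomp Require Import all_boot all_order all_algebra.
From mathcomp Require Import all_classical all_reals all_analysis.

Set Implicit Arguments.
Unset Strict Implicit.
Unset Printing Implicit Defensive.

Import Order.TTheory GRing.Theory Num.Theory numFieldNormedType.Exports.

Local Open Scope classical_set_scope.
Local Open Scope ring_scope.

(* The Borel sigma-algebra; in particular on R^n = 'rV[R]_n. *)
Section borel_matrix.
Variables (R : realType) (m n : nat).

Definition borel_mx : set (set 'M[R]_(m, n)) := <<s [set A | open A] >>.

Let borel_mx0 : borel_mx set0.
Proof. exact: sigma_algebra0. Qed.

Let borel_mxC A : borel_mx A -> borel_mx (~` A).
Proof. by move=> hA; rewrite -setTD; exact: sigma_algebraCD. Qed.

Let borel_mx_bigcup (F : (set 'M[R]_(m, n))^nat) :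
  (forall i, borel_mx (F i)) -> borel_mx (\bigcup_i F i).
Proof. exact: sigma_algebra_bigcup. Qed.

HB.instance Definition _ := @isMeasurable.Build
  (sigma_display [set A : set 'M[R]_(m, n) | open A])
  'M[R]_(m, n) borel_mx borel_mx0 borel_mxC borel_mx_bigcup.

End borel_matrix.

Section partial_order.
Context {R : realType} {k : nat}.

Definition vle (s t : 'rV[R]_k) : Prop := forall j, s ord0 j <= t ord0 j.

Definition vmin (s t : 'rV[R]_k) : 'rV[R]_k :=
  \row_j Num.min (s ord0 j) (t ord0 j).

Definition orthant : set 'rV[R]_k := [set s | vle 0 s].

(* Right-continuity, and existence of left limits, along the sequences that are
   monotone for the partial order. *)
Definition cadlag_vle {d : nat} (x : 'rV[R]_k -> 'rV[R]_d) : Prop :=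
  forall s, vle 0 s ->
    (forall u : nat -> 'rV[R]_k,
       (forall n, vle s (u n)) -> (forall n, vle (u n.+1) (u n)) ->
       u @ \oo --> s -> (x \o u) @ \oo --> x s) /\
    (forall u : nat -> 'rV[R]_k,
       (forall n, vle 0 (u n)) -> (forall n, vle (u n) (u n.+1)) ->
       u @ \oo --> s -> cvg ((x \o u) @ \oo)).

End partial_order.

Definition cadlag {R : realType} {k : nat} (y : R -> 'rV[R]_k) : Prop :=
  forall t : R, 0 <= t ->
    y u @[u --> t^'+] --> y t /\ (0 < t -> cvg (y u @[u --> t^'-])).

(* B_b(R^d) is the predicate [bounded_borel] on functions; an operator on
   B_b(R^d) is a map on all functions, of which only the values on B_b(R^d)
   are constrained. *)
Section bounded_borel_functions.
Context {R : realType} {d : nat}.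
Implicit Types (f g : 'rV[R]_d -> R) (T : ('rV[R]_d -> R) -> 'rV[R]_d -> R).

Definition bounded_borel f : Prop := measurable_fun setT f /\ bounded_fun f.

Definition sup_norm f : R := sup (range (fun x => `|f x|)).

Definition linear_on_Bb T : Prop :=
  (forall f, bounded_borel f -> bounded_borel (T f)) /\
  (forall (a : R) f g, bounded_borel f -> bounded_borel g ->
     T (fun x => a * f x + g x) =1 (fun x => a * T f x + T g x)).

Definition bounded_linear_on_Bb T : Prop :=
  linear_on_Bb T /\
  exists C : R, forall f, bounded_borel f -> sup_norm (T f) <= C * sup_norm f.

Definition multiparameter_semigroup {k : nat}
    (T : 'rV[R]_k -> ('rV[R]_d -> R) -> 'rV[R]_d -> R) : Prop :=
  [/\ forall s, vle 0 s -> bounded_linear_on_Bb (T s),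
      forall f, bounded_borel f -> T 0 f =1 f &
      forall s t f, vle 0 s -> vle 0 t -> bounded_borel f ->
        T (s + t) f =1 T s (T t f)].

Definition strongly_continuous {k : nat}
    (T : 'rV[R]_k -> ('rV[R]_d -> R) -> 'rV[R]_d -> R) : Prop :=
  forall f, bounded_borel f ->
    sup_norm (fun x => T s f x - f x)
      @[s --> within orthant (nbhs (0 : 'rV[R]_k))] --> 0.

Definition Markov_evolution
    (U : R -> R -> ('rV[R]_d -> R) -> 'rV[R]_d -> R) : Prop :=
  (forall t1 t2 : R, 0 <= t1 <= t2 -> linear_on_Bb (U t1 t2)) /\
  (forall (t : R) f, 0 <= t -> bounded_borel f -> U t t f =1 f) /\
  (forall (t1 t2 t3 : R) f, 0 <= t1 -> t1 <= t2 -> t2 <= t3 ->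
     bounded_borel f ->
     U t1 t2 (U t2 t3 f) =1 U t1 t3 f) /\
  (forall (t1 t2 : R) f, 0 <= t1 <= t2 -> bounded_borel f ->
     (forall x, 0 <= f x) -> forall x, 0 <= U t1 t2 f x) /\
  (forall (t1 t2 : R) f, 0 <= t1 <= t2 -> bounded_borel f ->
     sup_norm (U t1 t2 f) <= sup_norm f) /\
  (forall t1 t2 : R, 0 <= t1 <= t2 -> U t1 t2 (fun=> 1) =1 (fun=> 1)).

Definition normal_evolution
    (U : R -> R -> ('rV[R]_d -> R) -> 'rV[R]_d -> R) : Prop :=
  forall (t1 t2 : R) f, 0 <= t1 <= t2 -> bounded_borel f ->
    bounded_borel (U t1 t2 f).

End bounded_borel_functions.

(* The sigma-algebra sigma(Z i, i in D). *)
Definition sigma_of {Omega I : Type} {dT : measure_display}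
    {E : measurableType dT} (D : set I) (Z : I -> Omega -> E) :
    set (set Omega) :=
  <<s \bigcup_(i in D) preimage_set_system setT (Z i) measurable >>.

Definition measurable_wrt {Omega : Type} {dT : measure_display}
    {E : measurableType dT} (G : set (set Omega)) (W : Omega -> E) : Prop :=
  forall B, measurable B -> G (W @^-1` B).

Section one_probability.
Context {dO : measure_display} {Omega : measurableType dO} {R : realType}.
Variable P : probability Omega R.

(* W is a version of E[Z | G]. *)
Definition is_condexp (G : set (set Omega)) (Z W : Omega -> R) : Prop :=
  [/\ measurable_wrt G W,
      P.-integrable setT (EFin \o W) &
      forall A, G A ->
        (\int[P]_(w in A) (W w)%:E = \int[P]_(w in A) (Z w)%:E)%E].

(* E[Z | G] = E[Z | H] almost surely. *)
Definition same_condexp (G H : set (set Omega)) (Z : Omega -> R) : Prop :=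
  exists V W, [/\ is_condexp G Z V, is_condexp H Z W & V = W %[ae P]].

Definition independent_processes {I J : Type} {dE dF : measure_display}
    {E : measurableType dE} {F : measurableType dF}
    (DI : set I) (X : I -> Omega -> E) (DJ : set J) (S : J -> Omega -> F) :
    Prop :=
  forall A B, sigma_of DI X A -> sigma_of DJ S B ->
    P (A `&` B) = (P A * P B)%E.

Section multiparameter.
Variable k : nat.

Definition filtration (F : 'rV[R]_k -> set (set Omega)) : Prop :=
  (forall s, vle 0 s -> sigma_algebra setT (F s) /\ F s `<=` measurable) /\
  (forall s t, vle 0 s -> vle s t -> F s `<=` F t).

Definition complete_filtration (F : 'rV[R]_k -> set (set Omega)) : Prop :=
  forall s, vle 0 s -> P.-negligible `<=` F s.

Definition commuting (F : 'rV[R]_k -> set (set Omega)) : Prop :=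
  forall s t (Z : Omega -> R), vle 0 s -> vle 0 t ->
    measurable_wrt (F t) Z -> bounded_fun Z ->
    same_condexp (F s) (F (vmin s t)) Z.

Variable d : nat.

Definition Markov_wrt (F : 'rV[R]_k -> set (set Omega))
    (X : 'rV[R]_k -> Omega -> 'rV[R]_d)
    (T : 'rV[R]_k -> ('rV[R]_d -> R) -> 'rV[R]_d -> R) : Prop :=
  forall s t f, vle 0 s -> vle 0 t -> bounded_borel f ->
    is_condexp (F s) (f \o X (s + t)) (T t f \o X s).

End multiparameter.

Section one_parameter.
Variable k : nat.
Variable S : R -> Omega -> 'rV[R]_k.

Definition independent_increments : Prop :=
  forall (n : nat) (t : nat -> R) (B : nat -> set 'rV[R]_k),
    0 <= t 0%N -> (forall i, t i <= t i.+1) ->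
    (forall i, measurable (B i)) ->
    (P (\bigcap_(i in `I_n) [set w | B i (S (t i.+1) w - S (t i) w)%R]) =
     \prod_(i < n) P [set w | B i (S (t i.+1) w - S (t i) w)%R])%E.

Definition continuous_in_probability : Prop :=
  forall t e : R, 0 <= t -> 0 < e ->
    P [set w | e < `|S u w - S t w|]
      @[u --> within [set u : R | 0 <= u] (nbhs t)] --> (0 : \bar R)%E.

Definition additive_process : Prop :=
  [/\ forall t : R, 0 <= t -> measurable_fun setT (S t),
      {ae P, forall w, S 0 w = 0},
      independent_increments,
      continuous_in_probability &
      {ae P, forall w, cadlag (S ^~ w)}].

Definition additive_subordinator : Prop :=
  [/\ additive_process,
      forall (t : R) w, 0 <= t -> vle 0 (S t w) &
      {ae P, forall w, forall s t : R, 0 <= s -> s <= t ->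
         vle (S s w) (S t w)}].

End one_parameter.

Section one_parameter_Markov.
Variables (d : nat) (Y : R -> Omega -> 'rV[R]_d).

(* The Markov property with respect to the natural filtration of Y. *)
Definition Markov_process : Prop :=
  (forall t : R, 0 <= t -> measurable_fun setT (Y t)) /\
  (forall (t1 t2 : R) f, 0 <= t1 <= t2 -> bounded_borel f ->
     same_condexp (sigma_of [set u : R | 0 <= u <= t1] Y) (sigma_of [set t1] Y)
       (f \o Y t2)).

(* U t1 t2 f is a version of y |-> E[f (Y t2) | Y t1 = y]. *)
Definition associated_evolution
    (U : R -> R -> ('rV[R]_d -> R) -> 'rV[R]_d -> R) : Prop :=
  forall (t1 t2 : R) f, 0 <= t1 <= t2 -> bounded_borel f ->
    is_condexp (sigma_of [set t1] Y) (f \o Y t2) (U t1 t2 f \o Y t1).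

(* p t1 t2 y B is a version of P(Y t2 \in B | Y t1 = y). *)
Definition transition_probabilities
    (p : R -> R -> 'rV[R]_d -> set 'rV[R]_d -> \bar R) : Prop :=
  forall (t1 t2 : R) B, 0 <= t1 <= t2 -> measurable B ->
    is_condexp (sigma_of [set t1] Y) (\1_B \o Y t2)
      (fun w => fine (p t1 t2 (Y t1 w) B)).

End one_parameter_Markov.

End one_probability.

(* p t1 t2 is a probability kernel, and U t1 t2 integrates against it. *)
Definition evolution_kernel {R : realType} {d : nat}
    (U : R -> R -> ('rV[R]_d -> R) -> 'rV[R]_d -> R)
    (p : R -> R -> 'rV[R]_d -> set 'rV[R]_d -> \bar R) : Prop :=
  forall t1 t2 : R, 0 <= t1 <= t2 ->
    exists K : R.-pker 'rV[R]_d ~> 'rV[R]_d,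
      (forall x B, measurable B -> K x B = p t1 t2 x B) /\
      (forall f x, bounded_borel f -> U t1 t2 f x = \int[K x]_y f y).

(* X is a homogeneous Markov process on Omega under the family (P x), and T is
   its semigroup.
   P x lives on a sigma-algebra <<s A x >> that may depend on the starting point
   x, and so may the filtration: F x s is to be thought of as a filtration
   completed under P x.  Had a single sigma-algebra F 0 to be complete under all
   the P x, then since {X 0 <> x} and {X 0 <> x'} are null for P x and P x' and
   cover Omega, F 0 would contain every subset of Omega and X would be
   deterministic.  Families A and F that are constant in x are allowed.
   Completeness of F x s means that it contains all P x-negligible sets. *)
Definition homogeneous_Markov_process {R : realType} {Omega : pointedType}
    {k d : nat} (A : 'rV[R]_d -> set (set Omega))
    (P : forall x, probability (g_sigma_algebraType (A x)) R)
    (X : 'rV[R]_k -> Omega -> 'rV[R]_d)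
    (T : 'rV[R]_k -> ('rV[R]_d -> R) -> 'rV[R]_d -> R) : Prop :=
  exists F : 'rV[R]_d -> 'rV[R]_k -> set (set Omega), forall x,
    filtration (F x : _ -> set (set (g_sigma_algebraType (A x)))) /\
    (forall s, vle 0 s -> measurable_wrt (F x s) (X s)) /\
    {ae P x, forall w, cadlag_vle (X ^~ w)} /\
    complete_filtration (P x) (F x) /\
    commuting (P x) (F x) /\
    Markov_wrt (P x) (F x) X T /\
    P x [set w | X 0 w = x] = 1%E.

Section subordination.
Context {R : realType} {Omega : pointedType} {k d : nat}.

(* mu_s(x, .), the law of X s under P x. *)
Definition law_from {A : 'rV[R]_d -> set (set Omega)}
    (P : forall x, probability (g_sigma_algebraType (A x)) R)
    (X : 'rV[R]_k -> Omega -> 'rV[R]_d) (s : 'rV[R]_k) (x : 'rV[R]_d)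
    (B : set 'rV[R]_d) : \bar R :=
  P x (X s @^-1` B).

Definition subordinated_evolution
    (T : 'rV[R]_k -> ('rV[R]_d -> R) -> 'rV[R]_d -> R)
    (pi : R -> R -> probability 'rV[R]_k R)
    (t1 t2 : R) (f : 'rV[R]_d -> R) (x : 'rV[R]_d) : R :=
  \int[pi t1 t2]_(s in orthant) T s f x.

Definition subordinated_kernel
    (mu : 'rV[R]_k -> 'rV[R]_d -> set 'rV[R]_d -> \bar R)
    (pi : R -> R -> probability 'rV[R]_k R)
    (t1 t2 : R) (x : 'rV[R]_d) (B : set 'rV[R]_d) : \bar R :=
  (\int[pi t1 t2]_(s in orthant) mu s x B)%E.

Definition subordinated_process
    (X : 'rV[R]_k -> Omega -> 'rV[R]_d) (S : R -> Omega -> 'rV[R]_k)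
    (t : R) (w : Omega) : 'rV[R]_d :=
  X (S t w) w.

End subordination.

(* Main.v *)
From HB Require Import structures.
Require Import Defs.
From mathcomp Require Import all_boot all_order all_algebra.
From mathcomp Require Import all_classical all_reals all_analysis.
From mathcomp Require Import measurable_realfun.

Set Implicit Arguments.
Unset Strict Implicit.
Unset Printing Implicit Defensive.

Import Order.TTheory GRing.Theory Num.Theory numFieldNormedType.Exports.

Local Open Scope classical_set_scope.
Local Open Scope ring_scope.

(* Freeze [S] and use the independence of [X] and [S].  For a fixed increasing
   path [v] of [S], an event of the past of [Y] up to [t1] is, as an event about
   [X], an event of the filtration of [X] at the multiparameter time [S t1 v].
   So the Markov property of [X] replaces [f (X (S t2 v))] by
   [T (S t2 v - S t1 v) f (X (S t1 v))].  As [S t2 - S t1] is independent of the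
   past of [S], averaging over [v] turns this into [U t1 t2 f (Y t1)].  The same
   independence of increments gives the evolution property of [U].
   Fubini's theorem needs joint measurability.  The dyadic approximation of a
   time from above takes countably many values, hence is harmless; in the limit,
   strong continuity makes [(s, y) |-> T s f y] jointly measurable, and
   right-continuity of the paths yields a jointly measurable version of [X]. *)

(** * Borel sets of R^n *)

(** The hypotheses on [X] and [T] concern times in the orthant, and the increments of [S] lie there
    only almost surely. Times are therefore passed through [pospart], which makes every integrand a
    bounded measurable function on the whole space and does not change the integrals. In an event of
    the past of [Y] the same [w] plays two roles, as a path of [X] and as a path of [S]. To freeze
    one role, the event is written, up to a null set, as the diagonal trace of a measurable set in a
    product of two copies of [Omega], one carrying the sigma-algebra of [X], the other that of [S]
    up to [t1]. The identity maps into these copies are the random elements to which independence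
    applies, so that freezing becomes Fubini's theorem for a product law. The measures [P x] live on
    sigma-algebras that vary with [x]; measurability in the starting point is therefore read off
    from the functions [T s f]. *)

Section countable_union.
Context {dT : measure_display} {T : measurableType dT}.

Lemma countType_bigcup_measurable (I : countType) (F : I -> set T) :
  (forall i, measurable (F i)) -> measurable (\bigcup_i F i).
Proof.
move=> mF; pose G (n : nat) := if unpickle n is Some i then F i else set0.
rewrite (_ : \bigcup_i F i = \bigcup_n G n).
  by apply: bigcupT_measurable => n; rewrite /G; case: unpickle.
apply/seteqP; split=> [x [i _ Fx]|x [n _]].
  by exists (pickle i) => //; rewrite /G pickleK.
by rewrite /G; case: unpickle => // i Fx; exists i.
Qed.

End countable_union.

Section borel_vectors.
Context {R : realType} {n : nat}.

Lemma measurable_coord (j : 'I_n) :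
  measurable_fun setT (fun s : 'rV[R]_n => s ord0 j).
Proof.
apply: (measurability _ (RGenOpens.measurableE R)) => _ /= -[_ [a [b ->]] <-].
rewrite setTI; apply: sub_sigma_algebra => /=.
apply: open_comp; last exact: interval_open.
by move=> x _; exact: coord_continuous.
Qed.

(** An open set is the union of the boxes with rational centre and half-width [i.2.+1%:R^-1] that it
    contains. There are countably many of them, and the preimage of a box is a finite intersection
    of events about the coordinates. *)
Lemma measurable_rVP {dT} {T : measurableType dT} (f : T -> 'rV[R]_n) :
  (forall j, measurable_fun setT (fun w => f w ord0 j)) ->
  measurable_fun setT f.
Proof.
move=> mf.
have mE : @measurable _ 'rV[R]_n = <<s [set A | open A] >> by [].
apply: (measurability _ mE).
move=> _ [U /= oU <-]; rewrite setTI.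
pose box (i : 'rV[rat]_n * nat) : set 'rV[R]_n :=
  [set y | forall j, `|y ord0 j - ratr (i.1 ord0 j)| < i.2.+1%:R^-1].
pose F i := if pselect (box i `<=` U) then f @^-1` box i else set0.
rewrite (_ : f @^-1` U = \bigcup_i F i).
  apply: countType_bigcup_measurable => i; rewrite /F; case: pselect => [hb|hb];
    last exact: measurable0.
  rewrite (_ : f @^-1` box i = \bigcap_(j in [set: 'I_n])
      (fun w => f w ord0 j) @^-1`
        [set r | `|r - ratr (i.1 ord0 j)| < i.2.+1%:R^-1]).
    apply: fin_bigcap_measurable; first exact: finite_finset.
    move=> j _.
    rewrite -[X in measurable X]setTI; apply: mf => //.
    have := @ball_open R R (ratr (i.1 ord0 j)) i.2.+1%:R^-1.
    move=> /open_measurable; congr measurable.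
    by apply/seteqP; split=> r; rewrite /ball /= distrC.
  apply/seteqP; split=> [w h j _|w h j]; first exact: h.
  exact: (h j I).
apply/seteqP; split=> [w Uw|w [i _]]; last first.
  by rewrite /F; case: pselect => // h /h.
have /nbhs_ballP [e /= e0 eU] : nbhs (f w) U by exact: open_nbhs_nbhs.
(* The half-width must be below [e / 2]: a point of the box is compared with [f w] through the
   centre of the box. *)
pose m := Num.truncn (2 / e).
have m0 : 0 < m.+1%:R^-1 :> R by rewrite invr_gt0.
have me : m.+1%:R^-1 + m.+1%:R^-1 < e.
  suff h : m.+1%:R^-1 < e / 2 by rewrite [ltRHS]splitr ltrD.
  rewrite -[ltRHS]invrK ltf_pV2 ?posrE ?invr_gt0 ?divr_gt0//.
  by rewrite invf_div truncnS_gt.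
have /choice [q hq] : forall j : 'I_n, exists q : rat,
    `|f w ord0 j - ratr q| < m.+1%:R^-1.
  move=> j; have /rat_in_itvoo [q] :
    f w ord0 j - m.+1%:R^-1 < f w ord0 j + m.+1%:R^-1.
    by rewrite ltrD2l (lt_trans _ m0)// oppr_lt0.
  by rewrite in_itv/= => /andP[h1 h2]; exists q; rewrite distrC ltr_distl h1 h2.
pose i := (\row_j q j, m).
have wi : box i (f w) by move=> j; rewrite mxE; exact: hq.
have biU : box i `<=` U.
  move=> y yi; apply: eU; split => // a j; rewrite (ord1 a) /ball /=.
  rewrite -(subrKA (ratr (q j))) (le_lt_trans (ler_normD _ _))//.
  apply: (lt_trans _ me); apply: ltrD; first exact: hq.
  by have := yi j; rewrite mxE distrC.
by exists i => //; rewrite /F; case: pselect.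
Qed.

Lemma measurable_coordP {dT} {T : measurableType dT} (f : T -> 'rV[R]_n) j :
  measurable_fun setT f -> measurable_fun setT (fun w => f w ord0 j).
Proof. by move=> mf; exact: (measurableT_comp (measurable_coord j) mf). Qed.

Lemma measurable_rVD {dT} {T : measurableType dT} (f g : T -> 'rV[R]_n) :
  measurable_fun setT f -> measurable_fun setT g ->
  measurable_fun setT (fun w => f w + g w).
Proof.
move=> mf mg; apply: measurable_rVP => j.
under eq_fun do rewrite mxE.
by apply: measurable_funD; exact: measurable_coordP.
Qed.

Lemma measurable_rVB {dT} {T : measurableType dT} (f g : T -> 'rV[R]_n) :
  measurable_fun setT f -> measurable_fun setT g ->
  measurable_fun setT (fun w => f w - g w).
Proof.
move=> mf mg; apply: measurable_rVP => j.
under eq_fun do rewrite !mxE.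
by apply: measurable_funB; exact: measurable_coordP.
Qed.

Lemma measurable_orthant : measurable (@orthant R n).
Proof.
rewrite (_ : orthant = \bigcap_(j in [set: 'I_n])
    (fun s : 'rV[R]_n => s ord0 j) @^-1` `[0, +oo[).
  apply: fin_bigcap_measurable; first exact: finite_finset.
    move=> j _.
  by rewrite -[X in measurable X]setTI; exact: measurable_coord.
apply/seteqP; split=> [s h j _|s h j] /=.
  by rewrite in_itv/= andbT; have := h j; rewrite mxE.
by have := h j I; rewrite /= in_itv/= andbT mxE.
Qed.

Lemma measurable_rV_set1 (x : 'rV[R]_n) : measurable [set x].
Proof.
rewrite (_ : [set x] = \bigcap_(j in [set: 'I_n])
    (fun s : 'rV[R]_n => s ord0 j) @^-1` [set x ord0 j]).
  apply: fin_bigcap_measurable; first exact: finite_finset.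
  by move=> j _; rewrite -[X in measurable X]setTI; exact: measurable_coord.
apply/seteqP; split=> [s -> j _|s h] //=.
by apply/rowP => j; exact: (h j I).
Qed.

End borel_vectors.

(** * Bounded measurable functions on probability spaces *)

Section bounded_measurable.
Context {R : realType}.

(** On R^d this unfolds to the same proposition as [bounded_borel], so the closure lemmas below
    apply to both. *)
Definition bounded_measurable {dT} {T : measurableType dT} (f : T -> R) :
    Prop :=
  measurable_fun setT f /\ bounded_fun f.

Lemma bounded_fun_leP {T : Type} (f : T -> R) :
  bounded_fun f <-> exists M, forall x, `|f x| <= M.
Proof.
split=> [[M [_ hM]]|[M hM]].
  (* [bounded_fun] gives the bound by every number strictly above [M], not by [M] itself. *)
  by exists (M + 1) => x; apply: (hM (M + 1)) => //; rewrite ltrDl.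
exists M; split; first exact: num_real.
by move=> N MN x _ /=; apply: (le_trans (hM x)); exact: ltW.
Qed.

Context {dT dU : measure_display}.
Context {T : measurableType dT} {U : measurableType dU}.

Lemma bounded_measurable_comp (f : U -> R) (g : T -> U) :
  bounded_measurable f -> measurable_fun setT g ->
  bounded_measurable (fun x => f (g x)).
Proof.
move=> [mf /bounded_fun_leP[M hM]] mg; split; first exact: measurableT_comp.
by apply/bounded_fun_leP; exists M => x; exact: hM.
Qed.

Lemma bounded_measurable_cst (r : R) : bounded_measurable (fun _ : T => r).
Proof.
by split; [exact: measurable_cst|apply/bounded_fun_leP; exists `|r|].
Qed.

Lemma bounded_measurable_indic (A : set T) :
  measurable A -> bounded_measurable (\1_A : T -> R).
Proof.
move=> mA; split; first exact: measurable_indic.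
apply/bounded_fun_leP; exists 1 => x; rewrite indicE.
by case: (_ \in _); rewrite ?normr1 ?normr0.
Qed.

Lemma bounded_measurableD (f g : T -> R) : bounded_measurable f ->
  bounded_measurable g -> bounded_measurable (fun x => f x + g x).
Proof.
move=> [mf /bounded_fun_leP[M hM]] [mg /bounded_fun_leP[N hN]]; split.
  exact: measurable_funD.
apply/bounded_fun_leP; exists (M + N) => x.
by rewrite (le_trans (ler_normD _ _))// lerD.
Qed.

Lemma bounded_measurableM (f g : T -> R) : bounded_measurable f ->
  bounded_measurable g -> bounded_measurable (fun x => f x * g x).
Proof.
move=> [mf /bounded_fun_leP[M hM]] [mg /bounded_fun_leP[N hN]]; split.
  exact: measurable_funM.
by apply/bounded_fun_leP; exists (M * N) => x; rewrite normrM ler_pM.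
Qed.

Variable P : probability T R.

Lemma bounded_measurable_integrable (f : T -> R) (D : set T) :
  measurable D -> bounded_measurable f -> P.-integrable D (EFin \o f).
Proof.
move=> mD [mf bf]; apply: measurable_bounded_integrable => //.
- by rewrite (le_lt_trans (probability_le1 P _))// ltry.
- exact: measurable_funTS.
- have /bounded_fun_leP[M hM] := bf; exists M; split; first exact: num_real.
  by move=> N MN x _ /=; apply: (le_trans (hM x)); exact: ltW.
Qed.

Lemma EFin_Rintegral (f : T -> R) (D : set T) :
  measurable D -> bounded_measurable f ->
  (\int[P]_(x in D) f x)%:E = (\int[P]_(x in D) (f x)%:E)%E.
Proof.
move=> mD bf; rewrite /Rintegral fineK//; apply: integrable_fin_num => //.
exact: bounded_measurable_integrable.
Qed.

Lemma Rintegral_indicM (f : T -> R) (D : set T) :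
  \int[P]_(x in D) f x = \int[P]_x (\1_D x * f x).
Proof.
rewrite Rintegral_mkcond; apply: eq_Rintegral => x _.
by rewrite patchE indicE; case: ifP; rewrite ?mul1r ?mul0r.
Qed.

Lemma Rintegral_probability_cst (r : R) : \int[P]_x r = r.
Proof.
rewrite Rintegral_cst// -[RHS]mulr1; congr (_ * _).
by rewrite -[RHS]/(fine 1%E); congr fine; exact: probability_setT.
Qed.

Lemma Rintegral_norm_le (f : T -> R) (M : R) : measurable_fun setT f ->
  (forall x, `|f x| <= M) -> `|\int[P]_x f x| <= M.
Proof.
move=> mf hM; have bf : bounded_measurable f.
  by split=> //; apply/bounded_fun_leP; exists M.
have [_ /bounded_fun_leP[N hN]] := bf.
apply: le_trans (_ : \int[P]_x `|f x| <= _).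
  apply: le_normr_Rintegral => //; exact: bounded_measurable_integrable.
rewrite -[leRHS]Rintegral_probability_cst; apply: le_Rintegral => //.
- apply: bounded_measurable_integrable => //; split.
    exact: measurableT_comp.
  by apply/bounded_fun_leP; exists N => x; rewrite normr_id.
- by apply: bounded_measurable_integrable => //; exact: bounded_measurable_cst.
Qed.

Lemma ae_eq_Rintegral (f g : T -> R) : measurable_fun setT f ->
  measurable_fun setT g -> {ae P, forall x, f x = g x} ->
  \int[P]_x f x = \int[P]_x g x.
Proof.
move=> mf mg fg; congr fine; apply: ae_eq_integral => //.
- exact/measurable_EFinP.
- exact/measurable_EFinP.
- by apply: filterS fg => x /= -> _.
Qed.

Lemma Rintegral_distribution (phi : {mfun T >-> U}) (f : U -> R) :
  bounded_measurable f ->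
  \int[distribution P phi]_x f x = \int[P]_x f (phi x).
Proof.
move=> bf; congr fine; rewrite integral_pushforward//.
  by apply/measurable_EFinP; case: bf.
rewrite preimage_setT; apply: (@bounded_measurable_integrable (f \o phi)) => //.
exact: bounded_measurable_comp.
Qed.

Lemma Rintegral_law (Q : probability U R) (phi : T -> U) (f : U -> R) :
  measurable_fun setT phi ->
  (forall B, measurable B -> Q B = P (phi @^-1` B)) ->
  bounded_measurable f -> \int[Q]_x f x = \int[P]_x f (phi x).
Proof.
move=> mphi hQ bf.
rewrite -(Rintegral_distribution (mfun_Sub (mem_set mphi)) bf).
by congr fine; apply: eq_measure_integral => B mB _; exact: hQ.
Qed.

End bounded_measurable.

(** * Fubini's theorem and product laws for bounded functions *)

Section bounded_fubini.
Context {R : realType} {d1 d2 : measure_display}.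
Context {T1 : measurableType d1} {T2 : measurableType d2}.
Variable H : T1 * T2 -> R.
Hypothesis bH : bounded_measurable H.

Lemma bounded_measurable_pair1 (x : T1) :
  bounded_measurable (fun y => H (x, y)).
Proof. exact: (bounded_measurable_comp bH (pair1_measurable x)). Qed.

Lemma bounded_measurable_pair2 (y : T2) :
  bounded_measurable (fun x => H (x, y)).
Proof. exact: (bounded_measurable_comp bH (pair2_measurable y)). Qed.

Let mEH : measurable_fun setT (EFin \o H).
Proof. by apply/measurable_EFinP; case: bH. Qed.

Let iEH (P : probability T1 R) (Q : probability T2 R) :
  (P \x Q)%E.-integrable setT (EFin \o H).
Proof.
case: bH => mH bdH; apply: measurable_bounded_integrable => //.
have PQ1 : (P \x Q)%E setT = (P setT * Q setT)%E.
  by rewrite -setXTT; exact: product_measure1E.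
by rewrite [ltLHS]PQ1 !probability_setT mule1 ltry.
Qed.

Lemma bounded_measurable_Rintegral (Q : probability T2 R) :
  bounded_measurable (fun x => \int[Q]_y H (x, y)).
Proof.
have [mH /bounded_fun_leP[M hM]] := bH; split.
  (* Measurability of the partial integral is extracted from integrability for a product measure,
     which requires some probability on [T1]. A Dirac mass serves; it needs a point, whence the
     separate empty case. *)
  have [[x _]|T10] := pselect (exists x : T1, True); last first.
    by move=> _ B _; rewrite setTI (_ : _ @^-1` B = set0)// -subset0 => x;
      case: T10; exists x.
  apply: (measurableT_comp (f := @fine R)) => //.
  exact: (measurable_fubini_F (iEH (dirac x) Q)).
apply/bounded_fun_leP; exists M => x; apply: Rintegral_norm_le => //.
by case: (bounded_measurable_pair1 x).
Qed.

Lemma bounded_Fubini (P : probability T1 R) (Q : probability T2 R) :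
  \int[P]_x \int[Q]_y H (x, y) = \int[Q]_y \int[P]_x H (x, y).
Proof.
congr fine; transitivity (\int[P]_x \int[Q]_y (H (x, y))%:E)%E.
  by apply: eq_integral => x _; rewrite EFin_Rintegral//;
    exact: bounded_measurable_pair1.
rewrite (Fubini (iEH P Q)); apply: eq_integral => y _.
by rewrite EFin_Rintegral//; exact: bounded_measurable_pair2.
Qed.

Lemma Rintegral_prod_meas1 (P : probability T1 R) (Q : probability T2 R) :
  \int[(P \x Q)%E]_z H z = \int[P]_x \int[Q]_y H (x, y).
Proof.
congr fine; rewrite -(integral12_prod_meas1 (iEH P Q)).
by apply: eq_integral => x _; rewrite EFin_Rintegral//;
  exact: bounded_measurable_pair1.
Qed.

End bounded_fubini.

Section independent_pair.
Context {R : realType} {d0 d1 d2 : measure_display} {T : measurableType d0}.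
Context {T1 : measurableType d1} {T2 : measurableType d2}.
Variable P : probability T R.
Variables (phi : T -> T1) (psi : T -> T2).
Hypotheses (mphi : measurable_fun setT phi) (mpsi : measurable_fun setT psi).
Hypothesis indep : forall A B, measurable A -> measurable B ->
  P (phi @^-1` A `&` psi @^-1` B) = (P (phi @^-1` A) * P (psi @^-1` B))%E.

(* The joint law of [phi] and [psi] is the product of their laws. *)
Lemma Rintegral_independent (H : T1 * T2 -> R) : bounded_measurable H ->
  \int[P]_w H (phi w, psi w) = \int[P]_w \int[P]_v H (phi w, psi v).
Proof.
move=> bH; pose X := mfun_Sub (mem_set mphi); pose Y := mfun_Sub (mem_set mpsi).
have mXY : measurable_fun setT (fun w => (phi w, psi w)).
  exact: measurable_fun_pair.
pose Z := mfun_Sub (mem_set mXY).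
rewrite -(Rintegral_distribution P Z bH).
transitivity (\int[(distribution P X \x distribution P Y)%E]_z H z).
  congr fine; apply: eq_measure_integral => B mB _ /=.
  apply/esym/(@product_measure_unique _ _ _ _ _ (distribution P X)
    (distribution P Y) (distribution P Z)) => //.
rewrite Rintegral_prod_meas1// -(@Rintegral_distribution _ _ _ _ _ P X
  (fun x => \int[P]_v H (x, psi v)))//.
  apply: eq_Rintegral => x _; apply: (Rintegral_distribution P Y).
  exact: bounded_measurable_pair1.
apply: (bounded_measurable_Rintegral (H := fun z => H (z.1, psi z.2))).
apply: (bounded_measurable_comp bH).
by apply: measurable_fun_pair => //; exact: measurableT_comp.
Qed.

End independent_pair.

(** * Dyadic approximation from above *)

Section dyadic.
Context {R : realType}.

(* As [truncn] vanishes on negative numbers, [dyadic m x] is [2 ^- m] when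
   [x < 0]: it approximates [max 0 x], not [x]. *)
Definition dyadic (m : nat) (x : R) : R :=
  (Num.truncn (2 ^+ m * x)).+1%:R / 2 ^+ m.

Let two_gt0 (m : nat) : 0 < 2 ^+ m :> R. Proof. by rewrite exprn_gt0. Qed.

Lemma dyadic_ge (m : nat) (x : R) : Num.max 0 x <= dyadic m x.
Proof.
rewrite ge_max; apply/andP; split; first by rewrite divr_ge0// ltW.
by rewrite ler_pdivlMr// mulrC ltW// truncnS_gt.
Qed.

Lemma dyadic_le (m : nat) (x : R) : dyadic m x <= Num.max 0 x + (2 ^+ m)^-1.
Proof.
rewrite /dyadic -addn1 natrD mulrDl div1r lerD2r ler_pdivrMr//.
have [x0|x0] := leP 0 x.
  by rewrite mulrC truncn_le mulr_ge0// ltW.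
rewrite mul0r lern0; apply/eqP/truncn0Pn.
by rewrite -ltNge (lt_trans _ ltr01)// pmulr_rlt0.
Qed.

Lemma dyadicS_le (m : nat) (x : R) : dyadic m.+1 x <= dyadic m x.
Proof.
rewrite /dyadic exprS -mulrA; set y := 2 ^+ m * x; set t := Num.truncn y.
have -> : t.+1%:R / 2 ^+ m = (t.+1 * 2)%N%:R / (2 * 2 ^+ m) :> R.
  by rewrite natrM invfM mulrA mulfK ?pnatr_eq0.
rewrite ler_pM2r ?invr_gt0 ?mulr_gt0// ler_nat muln2 doubleS ltnS.
(* The goal [truncn (2 * y) <= 2t + 1] amounts to [2 * y < 2 * (t + 1)], which is the defining bound
   of [t]. *)
rewrite truncn_le_nat -doubleS -muln2 natrM mulrC.
by rewrite ltr_pM2r// truncnS_gt.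
Qed.

End dyadic.

Section upper_grid.
Context {R : realType} {k : nat}.
Implicit Types s : 'rV[R]_k.

(** A measurable retraction onto the orthant: it extends functions of an admissible time to all of
    R^k. *)
Definition pospart s : 'rV[R]_k := \row_j Num.max 0 (s ord0 j).

Definition upper (m : nat) s : 'rV[R]_k := \row_j dyadic m (s ord0 j).

Lemma vle0_pospart s : vle 0 (pospart s).
Proof. by move=> j; rewrite !mxE le_max lexx. Qed.

Lemma pospart_id s : vle 0 s -> pospart s = s.
Proof.
move=> s0; apply/rowP => j; rewrite mxE; apply/max_idPr.
by have := s0 j; rewrite mxE.
Qed.

Lemma vle0D s t : vle 0 s -> vle 0 t -> vle 0 (s + t).
Proof.
move=> s0 t0 j; have := t0 j; have := s0 j; rewrite !mxE; exact: addr_ge0.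
Qed.

Lemma pospart_le_upper m s : vle (pospart s) (upper m s).
Proof. by move=> j; rewrite !mxE dyadic_ge. Qed.

(** Right-continuity in [cadlag_vle] is tested only along sequences decreasing for the partial
    order; this and [pospart_le_upper] make [upper ^~ s] such a sequence. *)
Lemma upperS_le m s : vle (upper m.+1 s) (upper m s).
Proof. by move=> j; rewrite !mxE dyadicS_le. Qed.

Lemma upper_cvg s : upper m s @[m --> \oo] --> pospart s.
Proof.
apply/cvg_ballP => e e0; near=> m; split => // i j.
rewrite (ord1 i) /ball /= distrC !mxE ger0_norm ?subr_ge0 ?dyadic_ge//.
rewrite ltrBlDl (le_lt_trans (dyadic_le _ _))// ltrD2l -div1r.
by near: m; exact: (near_infty_natSinv_expn_lt (PosNum e0)).
Unshelve. all: by end_near. Qed.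

Lemma measurable_pospart : measurable_fun setT pospart.
Proof.
apply: measurable_rVP => j.
apply: (eq_measurable_fun (fun s => Num.max 0 (s ord0 j))).
  by move=> s _; rewrite [RHS]mxE.
by apply: measurable_maxr => //; exact: measurable_coord.
Qed.

(* [upper m] takes countably many values, each on a measurable set. *)
Lemma measurable_upper_section {dT dE} {T : measurableType dT}
    {E : measurableType dE} (Z : 'rV[R]_k -> T -> E) (m : nat) :
  (forall s, vle 0 s -> measurable_fun setT (Z s)) ->
  measurable_fun setT (fun z : 'rV[R]_k * T => Z (upper m z.1) z.2).
Proof.
move=> mZ _ B mB; rewrite setTI.
pose val (q : 'rV[nat]_k) : 'rV[R]_k :=
  \row_j ((q ord0 j).+1%:R / 2 ^+ m).
pose cell (q : 'rV[nat]_k) : set 'rV[R]_k :=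
  \bigcap_(j in [set: 'I_k]) (fun s => s ord0 j) @^-1`
    [set x | Num.truncn (2 ^+ m * x) = q ord0 j].
have mcell q : measurable (cell q).
  apply: fin_bigcap_measurable; first exact: finite_finset.
  move=> j _; rewrite -[X in measurable X]setTI; apply: measurable_coord => //.
  rewrite -[X in measurable X]setTI.
  have mle n : measurable [set x : R | (Num.truncn (2 ^+ m * x) <= n)%N].
    rewrite (_ : [set x | _] = `]-oo, n.+1%:R / 2 ^+ m[%classic)//.
    apply/seteqP; split => x /=; rewrite in_itv/= ltr_pdivlMr ?exprn_gt0//;
      by rewrite truncn_le_nat mulrC.
  rewrite setTI.
  (* The value 0 is also taken at every negative number, so its level set is a whole half-line; the
     other level sets are differences of two half-lines. *)
  case: (q ord0 j) => [|n].
    rewrite (_ : [set x | _] =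
        [set x : R | (Num.truncn (2 ^+ m * x) <= 0)%N])//.
    by apply/seteqP; split => x /=; rewrite leqn0 => /eqP.
  rewrite (_ : [set x | _] = [set x : R | (Num.truncn (2 ^+ m * x) <= n.+1)%N]
     `\` [set x : R | (Num.truncn (2 ^+ m * x) <= n)%N]).
    exact: measurableD.
  apply/seteqP; split => x /=.
    by move=> ->; rewrite leqnn ltnn.
  by move=> [h1 /negP]; rewrite -ltnNge => h2; apply/eqP; rewrite eqn_leq h1.
have upE q s : cell q s -> upper m s = val q.
  by move=> h; apply/rowP => j; rewrite !mxE /dyadic (h j I).
rewrite (_ : _ @^-1` B =
    \bigcup_(q : 'rV[nat]_k) (cell q `*` (Z (val q) @^-1` B))).
  apply: countType_bigcup_measurable => q; apply: measurableX => //.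
  rewrite -[X in measurable X]setTI; apply: mZ => // j.
  by rewrite !mxE divr_ge0// exprn_ge0.
apply/seteqP; split=> [[s t] /= h|[s t] [q _ [/= /upE qs]]]; last by rewrite qs.
exists (\row_j Num.truncn (2 ^+ m * s ord0 j)) => //.
have c : cell (\row_j Num.truncn (2 ^+ m * s ord0 j)) s.
  by move=> j _ /=; rewrite mxE.
by split => //=; rewrite -(upE _ _ c).
Qed.

End upper_grid.

Section cadlag_version.
Context {R : realType} {k d : nat}.

Section version.
Context {T : Type}.
Variable X : 'rV[R]_k -> T -> 'rV[R]_d.

(* A jointly measurable process, equal to [X] along cadlag paths. *)
Definition joint_version (z : 'rV[R]_k * T) : 'rV[R]_d :=
  \row_j fine (limn_esup (fun m => (X (upper m z.1) z.2 ord0 j)%:E)).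

(** Right-continuity is applied along [upper ^~ s]. On the other paths the upper limit still exists,
    with [fine] as a default, which keeps the version measurable everywhere. *)
Lemma joint_versionE s w :
  cadlag_vle (X ^~ w) -> joint_version (s, w) = X (pospart s) w.
Proof.
move=> cX; apply/rowP => j; rewrite mxE /=.
have [/(_ (upper ^~ s)) + _] := cX _ (vle0_pospart s).
move=> /(_ (pospart_le_upper ^~ s) (upperS_le ^~ s) (@upper_cvg _ _ s)) c.
have c' : (X (upper m s) w ord0 j)%:E @[m --> \oo] -->
    (X (pospart s) w ord0 j)%:E.
  apply/fine_cvgP; split; first exact: nearW.
  exact: cvg_comp c (@coord_continuous R 1 d ord0 j _).
by have [_ ->] := cvg_limn_einf_sup c'.
Qed.

End version.

Lemma measurable_joint_version {dT} {T : measurableType dT}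
    (X : 'rV[R]_k -> T -> 'rV[R]_d) :
  (forall s, vle 0 s -> measurable_fun setT (X s)) ->
  measurable_fun setT (joint_version X).
Proof.
move=> mX; apply: measurable_rVP => j.
apply: (eq_measurable_fun (fun z => fine (limn_esup
    (fun m => (X (upper m z.1) z.2 ord0 j)%:E)))).
  by move=> z _; rewrite [RHS]mxE.
apply: (measurableT_comp (f := @fine R)) => //.
apply: measurable_fun_limn_esup => m; apply/measurable_EFinP.
exact: (measurable_coordP j (measurable_upper_section m mX)).
Qed.

End cadlag_version.

(** * The multiparameter semigroup *)

Section sup_norm.
Context {R : realType} {d : nat}.
Implicit Types f : 'rV[R]_d -> R.

Lemma sup_norm_le f (M : R) : (forall x, `|f x| <= M) -> sup_norm f <= M.
Proof.
move=> hM; apply: ge_sup; first by exists `|f 0|, 0.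
by move=> _ [x _ <-].
Qed.

Lemma le_sup_norm f x : bounded_fun f -> `|f x| <= sup_norm f.
Proof.
move=> /bounded_fun_leP[M hM]; apply: ub_le_sup; last by exists x.
by exists M => _ [y _ <-].
Qed.

End sup_norm.

Section semigroup.
Context {R : realType} {k d : nat} {Omega : pointedType}.
Variable A : 'rV[R]_d -> set (set Omega).
Variable P : forall x : 'rV[R]_d, probability (g_sigma_algebraType (A x)) R.
Variable X : 'rV[R]_k -> Omega -> 'rV[R]_d.
Variable T : 'rV[R]_k -> ('rV[R]_d -> R) -> 'rV[R]_d -> R.
Hypothesis hT : multiparameter_semigroup T.
Hypothesis hTc : strongly_continuous T.
Hypothesis hX : homogeneous_Markov_process P X T.

Lemma bounded_borel_semigroup s f :
  vle 0 s -> bounded_borel f -> bounded_borel (T s f).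
Proof. by have [+ _ _] := hT => /(_ s) /[apply] -[[+ _] _]; exact. Qed.

Lemma measurable_process x s : vle 0 s ->
  measurable_fun setT (X s : g_sigma_algebraType (A x) -> 'rV[R]_d).
Proof.
move=> s0; have [F /(_ x) [[hF _] [mX _]]] := hX.
move=> _ B mB; rewrite setTI; have [_ Fm] := hF _ s0.
by apply: (Fm (X s @^-1` B)); exact: mX.
Qed.

(** The Markov property at time 0, integrated over the whole space, equates the mean of [f (X s)]
    with that of [T s f (X 0)], and [X 0 = x] almost surely. *)
Lemma semigroupE s f x : vle 0 s -> bounded_borel f ->
  T s f x = \int[P x]_w f (X s w).
Proof.
move=> s0 bf.
have [F /(_ x) [[hF _] [_ [_ [_ [_ [hM X0]]]]]]] := hX.
have v0 : vle 0 (0 : 'rV[R]_k) by move=> j.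
have [[F0 FC _] _] := hF _ v0.
have FT : F x 0 setT by have := FC _ F0; rewrite setD0.
have [_ _ /(_ _ FT)] := hM _ _ _ v0 s0 bf.
rewrite add0r => /(congr1 fine) /= E.
rewrite -[RHS]E; transitivity (\int[P x]_w T s f x).
  by rewrite Rintegral_probability_cst.
have mX0 := @measurable_process x _ v0.
have [mTf _] := bounded_borel_semigroup s0 bf.
apply: ae_eq_Rintegral => //.
  exact: measurableT_comp.
have mN : measurable ([set w | X 0 w = x] : set (g_sigma_algebraType (A x))).
  by have := mX0 measurableT _ (measurable_rV_set1 x); rewrite setTI.
exists (~` [set w | X 0 w = x]); split.
- exact: measurableC.
- by rewrite probability_setC// X0 subee.
- by apply: subsetC => w /= ->.
Qed.

(** Boundedness of the operator yields some constant only; the representation as an expectation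
    yields the constant 1. *)
Lemma semigroup_norm_le s f x (M : R) : vle 0 s -> bounded_borel f ->
  (forall y, `|f y| <= M) -> `|T s f x| <= M.
Proof.
move=> s0 bf hM; rewrite semigroupE//; apply: Rintegral_norm_le => //.
by apply: measurableT_comp; [case: bf|exact: measurable_process].
Qed.

(* Writing [upper m s = pospart s + h] with [h] small and positive, the
   difference is [T (pospart s) (T h f - f)], and [T (pospart s)] is a
   contraction. *)
Lemma semigroup_upper_cvg f s y : bounded_borel f ->
  T (upper m s) f y @[m --> \oo] --> T (pospart s) f y.
Proof.
move=> bf; have p0 := vle0_pospart s.
pose h m := upper m s - pospart s.
have h0 m : vle 0 (h m).
  move=> j; have := pospart_le_upper m s j.
  by rewrite !mxE subr_ge0.
have hc : h @ \oo --> within orthant (nbhs (0 : 'rV[R]_k)).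
  have : h @ \oo --> (0 : 'rV[R]_k).
    rewrite -(subrr (pospart s)).
    by apply: cvgB; [exact: upper_cvg|exact: cvg_cst].
  move=> hc U /hc hU; have hU' : \forall m \near \oo, orthant (h m) -> U (h m).
    exact: hU.
  by apply: filterS hU' => m; apply; exact: h0.
have := cvg_comp _ _ hc (hTc bf).
move=> /cvgrPdist_le c; apply/cvgrPdist_le => e e0.
apply: filterS (c e e0) => m /=; rewrite sub0r normrN => he.
have bTh := bounded_borel_semigroup (h0 m) bf.
(* The difference is written with the factor [- 1] in front to have the shape [a * f + g] of
   [linear_on_Bb]. *)
have bD : bounded_borel (fun x => (- 1) * f x + T (h m) f x).
  by apply: bounded_measurableD => //; apply: bounded_measurableM => //;
    exact: bounded_measurable_cst.
have -> : T (pospart s) f y - T (upper m s) f y =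
    - T (pospart s) (fun x => (- 1) * f x + T (h m) f x) y.
  have [+ _ Tadd] := hT => /(_ _ p0) [[_ Tlin] _].
  rewrite Tlin// -Tadd// /h (addrC (pospart s)) subrK.
  by rewrite mulN1r opprD opprK.
rewrite normrN; apply: semigroup_norm_le => // x.
have := le_trans (ler_norm _) he; apply: le_trans.
have -> : -1 * f x + T (h m) f x = T (h m) f x - f x by rewrite mulN1r addrC.
apply: (@le_sup_norm _ _ (fun x => T (h m) f x - f x)).
have [_] := bD; congr bounded_fun; apply/funext => z.
by rewrite mulN1r addrC.
Qed.

Lemma bounded_measurable_semigroup f : bounded_borel f ->
  bounded_measurable (fun z : 'rV[R]_k * 'rV[R]_d => T (pospart z.1) f z.2).
Proof.
move=> bf; split.
  apply: (@measurable_fun_cvg _ _ _ setT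
    (fun m (z : 'rV[R]_k * 'rV[R]_d) => T (upper m z.1) f z.2)) => [m|z _].
    apply: (measurable_upper_section (Z := fun s => T s f)) => s s0.
    by have [] := bounded_borel_semigroup s0 bf.
  exact: semigroup_upper_cvg.
have [_ /bounded_fun_leP[M hM]] := bf; apply/bounded_fun_leP; exists M => z.
by apply: semigroup_norm_le => //; exact: vle0_pospart.
Qed.

End semigroup.

(** * Independence of the past and the increments of an additive process *)

Section sigma_algebra_of_a_family.
Context {Omega I : Type} {dE : measure_display} {E : measurableType dE}.
Implicit Types (D : set I) (Z : I -> Omega -> E).

Lemma sigma_algebra_sigma_of D Z : sigma_algebra setT (sigma_of D Z).
Proof. exact: smallest_sigma_algebra. Qed.

Lemma sigma_of_preimage D Z i B : D i -> measurable B ->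
  sigma_of D Z (Z i @^-1` B).
Proof.
move=> Di mB; apply: sub_sigma_algebra; exists i => //.
by exists B; rewrite ?setTI.
Qed.

Lemma sigma_of_sub D Z (H : set (set Omega)) : sigma_algebra setT H ->
  (forall i B, D i -> measurable B -> H (Z i @^-1` B)) -> sigma_of D Z `<=` H.
Proof.
move=> sH hH; apply: smallest_sub => //.
by move=> _ [i Di [B mB <-]]; rewrite setTI; exact: hH.
Qed.

Lemma sigma_of_subset D D' Z : D `<=` D' -> sigma_of D Z `<=` sigma_of D' Z.
Proof.
move=> DD'; apply: sigma_of_sub; first exact: sigma_algebra_sigma_of.
by move=> i B Di mB; apply: sigma_of_preimage => //; exact: DD'.
Qed.

(** Good sets principle: the events that agree on [N] with a preimage under [h] of a member of [H]
    form a sigma-algebra. It serves with [N] almost sure, once for [h] the identity and once for the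
    diagonal map. *)
Lemma sigma_of_trace {V : Type} D Z (h : Omega -> V) (N : set Omega)
    (H : set (set V)) : sigma_algebra setT H ->
  (forall i B, D i -> measurable B ->
     exists2 C, H C & Z i @^-1` B `&` N = h @^-1` C `&` N) ->
  forall A, sigma_of D Z A -> exists2 C, H C & A `&` N = h @^-1` C `&` N.
Proof.
move=> [H0 HC HU] hH.
apply: (@sigma_of_sub D Z [set A | exists2 C, H C & A `&` N = h @^-1` C `&` N]).
  split.
  - by exists set0 => //; rewrite preimage_set0.
  - move=> A [C hC e]; exists (setT `\` C); first exact: HC.
    have AC w : N w -> A w <-> C (h w).
      move=> Nw; have /= := congr1 (fun X : set Omega => X w) e.
      rewrite /setI /= => AC; split=> x.
        by have : A w /\ N w by []; rewrite AC => -[].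
      by have : C (h w) /\ N w by []; rewrite -AC => -[].
    by apply/seteqP; split=> w [/= [_ nA] Nw]; split=> //; split=> //;
      move/(AC w Nw).
  - move=> F hF; have /choice[G hG] : forall n, exists C,
        H C /\ F n `&` N = h @^-1` C `&` N.
      by move=> n; have [C ? ?] := hF n; exists C.
    exists (\bigcup_n G n); first by apply: HU => n; have [] := hG n.
    rewrite preimage_bigcup !setI_bigcupl; apply: eq_bigcupr => n _.
    by have [] := hG n.
by move=> i B Di mB; exact: hH.
Qed.

(** Naming the generators lets [g_sigma_algebraType] turn [Omega] into a measurable type whose
    measurable sets are those of [sigma_of D Z]. *)
Definition generators_of D Z : set (set Omega) :=
  \bigcup_(i in D) preimage_set_system setT (Z i) measurable.

End sigma_algebra_of_a_family.

Lemma measurable_generators_of {Omega : pointedType} {I : Type}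
    {dE : measure_display} {E : measurableType dE}
    (D : set I) (Z : I -> Omega -> E) i : D i ->
  measurable_fun setT (Z i : g_sigma_algebraType (generators_of D Z) -> E).
Proof. by move=> Di _ B mB; rewrite setTI; exact: sigma_of_preimage. Qed.

Lemma measurable_sigma_of {d : measure_display} {Omega : measurableType d}
    {I : Type} {dE : measure_display} {E : measurableType dE}
    (D : set I) (Z : I -> Omega -> E) :
  (forall i, D i -> measurable_fun setT (Z i)) -> sigma_of D Z `<=` measurable.
Proof.
move=> mZ; apply: sigma_of_sub; first exact: sigma_algebra_measurable.
by move=> i B Di mB; rewrite -[X in measurable X]setTI; exact: mZ.
Qed.

(** * Independence from a pi-system, and events equal up to a null set *)

Section events.
Context {R : realType} {dT : measure_display} {T : measurableType dT}.
Variable P : probability T R.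

(** For fixed [C] both sides are finite measures in [A] with the same total mass; they agree on the
    pi-system [G], hence on what it generates. *)
Lemma independent_generated (G : set (set T)) (C : set T) :
  setI_closed G -> G `<=` measurable -> measurable C ->
  (forall A, G A -> P (A `&` C) = (P A * P C)%E) ->
  forall A, <<s G >> A -> P (A `&` C) = (P A * P C)%E.
Proof.
move=> GI Gm mC GC A GA.
have C0 : 0 <= fine (P C) by apply: fine_ge0.
pose m1 : {measure set T -> \bar R} := mrestr P mC.
pose m2 : {measure set T -> \bar R} := mscale (NngNum C0) P.
have m2E B : m2 B = (P B * P C)%E.
  have -> : m2 B = ((fine (P C))%:E * P B)%E by [].
  by rewrite fineK ?fin_num_measure// muleC.
rewrite -m2E; change (m1 A = m2 A).
pose H := [set X | G X /\ X `<=` [set: T]].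
have HE : H = G by apply/seteqP; split=> [X []//|X GX]; split.
have Hm : H `<=` measurable by rewrite HE.
have HI : setI_closed H by rewrite HE.
apply: (@g_sigma_algebra_measure_unique_trace _ R T G setT measurableT
  Hm HI m1 m2) => //.
- by rewrite m2E; change (P (setT `&` C) = P setT * P C)%E;
    rewrite setTI probability_setT mul1e.
- by move=> B [GB _]; rewrite m2E; exact: GC.
- change (P (setT `&` C) < +oo)%E; rewrite setTI ltey_eq fin_num_measure//.
- by rewrite -/H HE.
Qed.

(** [N] itself may fail to be measurable; removing a measurable null set that covers its complement
    from [A] and from [B] leaves the same set. *)
Lemma probability_ae_trace (A B N : set T) : measurable A -> measurable B ->
  P.-negligible (~` N) -> A `&` N = B `&` N -> P A = P B.
Proof.
move=> mA mB [M [mM M0 NM]] e.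
have h C : measurable C -> P C = P (C `\` M).
  move=> mC; rewrite (measureDI P mC mM).
  rewrite (subset_measure0 (measurableI _ _ mC mM) mM _ M0)//.
  exact: adde0.
rewrite h// [RHS]h//; congr (P _).
have MN w : ~ M w -> N w by move=> nM; apply: contrapT => /NM.
apply/seteqP; split=> w [Cw nM]; (split=> //).
  by have [] : (B `&` N) w by rewrite -e; split=> //; exact: MN.
by have [] : (A `&` N) w by rewrite e; split=> //; exact: MN.
Qed.

End events.

Section increments.
Context {R : realType} {k : nat} {dT : measure_display} {T : measurableType dT}.
Variable P : probability T R.
Variable S : R -> T -> 'rV[R]_k.
Hypothesis hS : additive_process P S.

Lemma measurable_increment t1 t2 : 0 <= t1 -> 0 <= t2 ->
  measurable_fun setT (fun w => S t2 w - S t1 w).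
Proof. by have [mS _ _ _ _] := hS => ? ?; apply: measurable_rVB; exact: mS. Qed.

(* The times [0], [s] in increasing order and [t1], then [t2] forever. *)
Let grid (s : seq R) (t1 t2 : R) (i : nat) : R :=
  nth t2 (0 :: rcons (sort <=%R s) t1) i.

Let increment_events (t : nat -> R) (n : nat) : set (set T) :=
  [set A | exists2 B : nat -> set 'rV[R]_k, (forall i, measurable (B i)) &
     A = \bigcap_(i in `I_n) [set w | B i (S (t i.+1) w - S (t i) w)]].

(* Almost surely [S 0 = 0], so up to a null set the values of [S] on the grid
   generate the same events as its increments along the grid. *)
Lemma independent_of_grid (s : seq R) t1 t2 (C : set 'rV[R]_k) :
  (forall u, u \in s -> 0 <= u <= t1) -> 0 <= t1 -> t1 <= t2 -> measurable C ->
  forall A, sigma_of [set` s] S A ->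
  P (A `&` [set w | C (S t2 w - S t1 w)]) =
  (P A * P [set w | C (S t2 w - S t1 w)]%R)%E.
Proof.
move=> hs t10 t12 mC A sA; have [mS S0 iS _ _] := hS.
pose t := grid s t1 t2; pose n := (size s).+1.
have tn : t n = t1.
  by rewrite /t /grid /= nth_rcons size_sort ltnn eqxx.
have tn1 : t n.+1 = t2.
  by rewrite /t /grid /= nth_default// size_rcons size_sort.
have ts i : t i <= t i.+1.
  pose L := 0 :: rcons (sort <=%R s) t1.
  have L_le x : x \in L -> x <= t2.
    rewrite inE mem_rcons inE mem_sort => /or3P[/eqP->|/eqP->//|/hs/andP[_ xt]].
      exact: le_trans t12.
    exact: le_trans t12.
  have sL : sorted <=%R L.
    rewrite /= rcons_path path_sortedE; last exact: le_trans.
    rewrite sort_sorted ?andbT; last exact: le_total.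
    apply/andP; split.
      by apply/allP => x; rewrite mem_sort => /hs /andP[].
    have := mem_last 0 (sort <=%R s).
    by rewrite inE mem_sort => /predU1P[->//|/hs /andP[]].
  rewrite /t /grid -/L; have [iL|iL] := ltnP i.+1 (size L).
    by move/sortedP: sL => /(_ t2 _ iL).
  rewrite [leRHS]nth_default//; have [iL'|iL'] := ltnP i (size L).
    by apply: L_le; exact: mem_nth.
  by rewrite nth_default.
have t0 i : 0 <= t i by elim: i => [|i IH]; rewrite ?(le_trans IH).
pose G := increment_events t n.
set D := [set w | C _].
have mD : measurable D.
  rewrite -[X in measurable X]setTI.
  by apply: measurable_increment => //; exact: le_trans t12.
have minc i B : measurable B ->
    measurable [set w | B (S (t i.+1) w - S (t i) w)].
  by move=> mB; rewrite -[X in measurable X]setTI; exact: measurable_increment.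
have GI : setI_closed G.
  move=> _ _ [B mB ->] [B' mB' ->]; exists (fun i => B i `&` B' i).
    by move=> i; exact: measurableI.
  by rewrite -bigcapI.
have Gm : G `<=` measurable.
  move=> _ [B mB ->]; apply: bigcap_measurable; first by exists 0%N.
  by move=> i _; exact: minc.
have indG B : <<s G >> B -> P (B `&` D) = (P B * P D)%E.
  apply: independent_generated => // _ [B' mB' ->].
  (* The condition on the increment from [t1] to [t2] is appended as number [n]. The product formula
     for [n.+1] increments then splits into that for [n] increments and one last factor. *)
  pose B'' i := if (i < n)%N then B' i else C.
  have mB'' i : measurable (B'' i) by rewrite /B''; case: ifP.
  have e : \bigcap_(i in `I_n) [set w | B' i (S (t i.+1) w - S (t i) w)] =
           \bigcap_(i in `I_n) [set w | B'' i (S (t i.+1) w - S (t i) w)].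
    by apply: eq_bigcapr => i /= ni; rewrite /B'' ni.
  have B''n : [set w | B'' n (S (t n.+1) w - S (t n) w)] = D.
    by rewrite /B'' ltnn tn1 tn.
  have := iS n.+1 t B'' (t0 0%N) ts mB''.
  rewrite big_ord_recr /= B''n -(iS n t B'' (t0 0%N) ts mB'') e.
  move=> <-; congr (P _); apply/seteqP; split=> w.
    move=> [h Dw] i /=; rewrite ltnS leq_eqVlt => /predU1P[->|]; last exact: h.
    by rewrite /B'' ltnn tn1 tn.
  move=> h; split; first by move=> i /= ni; apply: h => /=; exact: ltnW.
  by have := h n (ltnSn n); rewrite /= /B'' ltnn tn1 tn.
have mG : <<s G >> `<=` measurable.
  by apply: smallest_sub => //; exact: sigma_algebra_measurable.
have hinc j : (j < n)%N -> measurable_fun setT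
    ((fun w => S (t j.+1) w - S (t j) w) : g_sigma_algebraType G -> 'rV[R]_k).
  move=> jn _ B mB; rewrite setTI; apply: sub_sigma_algebra.
  exists (fun i => if i == j then B else setT); first by move=> i; case: ifP.
  apply/seteqP; split=> [w Bw i _ /=|w h]; first by case: ifP => // /eqP ->.
  by have := h j jn; rewrite /= eqxx.
have hgrid j : (j <= n)%N -> measurable_fun setT
    ((fun w => S (t j) w - S 0 w) : g_sigma_algebraType G -> 'rV[R]_k).
  elim: j => [_|j IH jn].
    rewrite (_ : (fun w => _) = cst 0); first exact: measurable_cst.
    by apply/funext => w; rewrite subrr.
  rewrite (_ : (fun w => _) = (fun w => (S (t j.+1) w - S (t j) w) +
    (S (t j) w - S 0 w))); last by apply/funext => w; rewrite subrKA.
  apply: measurable_rVD; first exact: hinc.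
  by apply: IH; exact: ltnW.
have [] := @sigma_of_trace T R _ _ T [set` s] S id [set w | S 0 w = 0] <<s G >>
  (smallest_sigma_algebra _ _) _ A sA.
  move=> u B /= us mB.
  have [j jn uE] : exists2 j, (j <= n)%N & t j = u.
    have us' : u \in sort <=%R s by rewrite mem_sort.
    exists (index u (sort <=%R s)).+1.
      by rewrite /n ltnS -(size_sort <=%R) index_size.
    rewrite /t /grid /= nth_rcons index_mem us'.
    exact: nth_index.
  exists [set w | B (S u w - S 0 w)].
    by have := hgrid j jn measurableT B mB; rewrite setTI uE.
  by apply/seteqP; split=> w [/= + Sw]; rewrite /preimage /= Sw subr0 => ?.
move=> A' GA' AA'.
have mA : measurable A.
  move: A sA {AA'}; apply: measurable_sigma_of => u /= us.
  by apply: mS; have /andP[] := hs _ us.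
have mA' : measurable A' by exact: mG.
rewrite -(probability_ae_trace mA' mA S0)//.
rewrite -indG//; apply: (probability_ae_trace _ _ S0).
- exact: measurableI.
- exact: measurableI.
- by rewrite -setIA (setIC D) setIA AA' -setIA (setIC _ D) setIA.
Qed.

(** Events about finitely many times up to [t1] generate the past and are stable under intersection,
    since two lists of times can be concatenated. *)
Lemma independent_of_past t1 t2 (C : set 'rV[R]_k) :
  0 <= t1 -> t1 <= t2 -> measurable C ->
  forall A, sigma_of [set u : R | 0 <= u <= t1] S A ->
  P (A `&` [set w | C (S t2 w - S t1 w)]) =
  (P A * P [set w | C (S t2 w - S t1 w)]%R)%E.
Proof.
move=> t10 t12 mC A sA; have [mS _ _ _ _] := hS.
pose G := [set B | exists2 s : seq R, (forall u, u \in s -> 0 <= u <= t1) &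
  sigma_of [set` s] S B].
apply: (independent_generated (G := G)).
- move=> B B' [s hs sB] [s' hs' sB']; exists (s ++ s').
    by move=> u; rewrite mem_cat => /orP[/hs|/hs'].
  have /sigma_algebraP : sigma_algebra setT (sigma_of [set` s ++ s'] S).
    exact: sigma_algebra_sigma_of.
  move=> /(_ (fun _ _ => @subsetT _ _))[_ _ _ +]; apply.
    by apply: sigma_of_subset sB => u /=; rewrite mem_cat => ->.
  by apply: sigma_of_subset sB' => u /=; rewrite mem_cat orbC => ->.
- move=> B [s hs]; apply: measurable_sigma_of => u /= us.
  by apply: mS; have /andP[] := hs _ us.
- rewrite -[X in measurable X]setTI.
  by apply: measurable_increment => //; exact: le_trans t12.
- move=> B [s hs sB]; exact: independent_of_grid sB.
- move: A sA; apply: sigma_of_sub; first exact: smallest_sigma_algebra.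
  move=> u B /= ut mB; apply: sub_sigma_algebra; exists [:: u].
    by move=> v; rewrite inE => /eqP ->.
  by apply: sigma_of_preimage => //=; rewrite inE.
Qed.

End increments.

(** * The subordinated evolution *)

Section evolution.
Context {R : realType} {k d : nat} {Omega : pointedType}.
Variable A : 'rV[R]_d -> set (set Omega).
Variable P : forall x : 'rV[R]_d, probability (g_sigma_algebraType (A x)) R.
Variable S : R -> Omega -> 'rV[R]_k.
Variable pi : R -> R -> probability 'rV[R]_k R.
Variable X : 'rV[R]_k -> Omega -> 'rV[R]_d.
Variable T : 'rV[R]_k -> ('rV[R]_d -> R) -> 'rV[R]_d -> R.
Hypothesis hS : forall x, additive_subordinator (P x) S.
Hypothesis hpi : forall x (t1 t2 : R) (B : set 'rV[R]_k),
  0 <= t1 <= t2 -> measurable B ->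
  pi t1 t2 B = P x [set w | B (S t2 w - S t1 w)].
Hypothesis hT : multiparameter_semigroup T.
Hypothesis hTc : strongly_continuous T.
Hypothesis hX : homogeneous_Markov_process P X T.

Let U := subordinated_evolution T pi.
Let Phi (f : 'rV[R]_d -> R) (s : 'rV[R]_k) (y : 'rV[R]_d) := T (pospart s) f y.

Lemma measurable_subordinator x t : 0 <= t ->
  measurable_fun setT (S t : g_sigma_algebraType (A x) -> 'rV[R]_k).
Proof. by have [[mS _ _ _ _] _ _] := hS x; exact: mS. Qed.

Lemma measurable_subordinator_increment x t1 t2 : 0 <= t1 <= t2 ->
  measurable_fun setT
    ((fun w => S t2 w - S t1 w) : g_sigma_algebraType (A x) -> 'rV[R]_k).
Proof.
move=> /andP[t10 t12]; have [aS _ _] := hS x.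
by apply: (measurable_increment aS) => //; exact: le_trans t12.
Qed.

Lemma increment_orthant x t1 t2 : 0 <= t1 <= t2 ->
  {ae P x, forall w, vle 0 (S t2 w - S t1 w)}.
Proof.
move=> /andP[t10 t12]; have [_ _ mono] := hS x.
apply: filterS mono => w /(_ _ _ t10 t12) h j.
by rewrite !mxE subr_ge0.
Qed.

Lemma law_orthant t1 t2 : 0 <= t1 <= t2 -> pi t1 t2 orthant = 1%E.
Proof.
move=> t12; rewrite (hpi 0 t12 measurable_orthant).
rewrite -(probability_setT (P 0)).
apply: (probability_ae_trace _ _ (increment_orthant 0 t12)) => //.
  rewrite -[X in measurable X]setTI.
  have mO := @measurable_orthant R k.
  exact: (measurable_subordinator_increment t12).
by rewrite setTI; apply/setIidr.
Qed.

Lemma bounded_measurable_slice f y : bounded_borel f ->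
  bounded_measurable (Phi f ^~ y).
Proof.
move=> bf; apply: (@bounded_measurable_pair2 _ _ _ _ _
  (fun z => T (pospart z.1) f z.2)).
exact: (bounded_measurable_semigroup hT hTc hX bf).
Qed.

Lemma evolutionE t1 t2 f y : 0 <= t1 <= t2 -> bounded_borel f ->
  U t1 t2 f y = \int[pi t1 t2]_s Phi f s y.
Proof.
move=> t12 bf; have bPhi := bounded_measurable_slice y bf.
have [mPhi _] := bPhi.
have mO := @measurable_orthant R k.
transitivity (\int[pi t1 t2]_(s in orthant) Phi f s y).
  by apply: eq_Rintegral => s; rewrite inE /Phi => /pospart_id ->.
rewrite Rintegral_indicM; apply: ae_eq_Rintegral => //.
  by apply: measurable_funM => //; exact: measurable_indic.
exists (~` @orthant R k); split; first exact: measurableC.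
  by rewrite probability_setC// law_orthant// subee.
by apply: subsetC => s /= os; rewrite indicE mem_set// mul1r.
Qed.

(** [x] and [y] are unrelated: [pi] is the law of the increment under every [P x], so any convenient
    starting point can carry [S]. *)
Lemma evolution_incrementE x t1 t2 f y : 0 <= t1 <= t2 -> bounded_borel f ->
  U t1 t2 f y = \int[P x]_w Phi f (S t2 w - S t1 w) y.
Proof.
move=> t12 bf; rewrite evolutionE//.
apply: (@Rintegral_law _ _ _ _ _ (P x) (pi t1 t2) (fun w => S t2 w - S t1 w)
  (Phi f ^~ y)).
- exact: measurable_subordinator_increment.
- by move=> B mB; exact: hpi.
- exact: bounded_measurable_slice.
Qed.

Lemma bounded_borel_evolution t1 t2 f : 0 <= t1 <= t2 -> bounded_borel f ->
  bounded_borel (U t1 t2 f).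
Proof.
move=> t12 bf.
have -> : U t1 t2 f = fun y => \int[pi t1 t2]_s Phi f s y.
  by apply/funext => y; exact: evolutionE.
apply: (bounded_measurable_Rintegral (H := fun z => Phi f z.2 z.1)).
apply: (bounded_measurable_comp (g := fun z => (z.2, z.1))
  (bounded_measurable_semigroup hT hTc hX bf)).
exact: measurable_fun_pair.
Qed.

Lemma evolution_norm_le t1 t2 f (M : R) y : 0 <= t1 <= t2 -> bounded_borel f ->
  (forall x, `|f x| <= M) -> `|U t1 t2 f y| <= M.
Proof.
move=> t12 bf hM; rewrite evolutionE//; apply: Rintegral_norm_le.
  by have [] := bounded_measurable_slice y bf.
by move=> s; apply: (semigroup_norm_le hT hX) => //; exact: vle0_pospart.
Qed.

Lemma evolution_linear t1 t2 (a : R) f g y : 0 <= t1 <= t2 ->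
  bounded_borel f -> bounded_borel g ->
  U t1 t2 (fun x => a * f x + g x) y = a * U t1 t2 f y + U t1 t2 g y.
Proof.
move=> t12 bf bg.
have bfg : bounded_borel (fun x => a * f x + g x).
  apply: bounded_measurableD => //; apply: bounded_measurableM => //.
  exact: bounded_measurable_cst.
have bPf := bounded_measurable_slice y bf.
have bPg := bounded_measurable_slice y bg.
rewrite !evolutionE// -RintegralZl//; last exact: bounded_measurable_integrable.
rewrite -RintegralD//.
- apply: eq_Rintegral => s _; rewrite /Phi.
  by have [/(_ _ (vle0_pospart s)) [[_ h] _] _ _] := hT; exact: h.
- apply: (@bounded_measurable_integrable _ _ _ _ 
    (fun s => a * Phi f s y)) => //.
  by apply: bounded_measurableM => //; exact: bounded_measurable_cst.
- exact: (@bounded_measurable_integrable _ _ _ _ (Phi g ^~ y)).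
Qed.

Lemma evolution_diag t f : 0 <= t -> bounded_borel f -> U t t f =1 f.
Proof.
move=> t0 bf y; rewrite (evolution_incrementE 0)// ?t0 ?lexx//.
transitivity (\int[P 0]_w f y); last exact: Rintegral_probability_cst.
apply: eq_Rintegral => w _; rewrite subrr /Phi pospart_id; last by move=> j.
by have [_ h _] := hT; exact: h.
Qed.

Lemma semigroup1 s y : vle 0 s -> T s (fun=> 1) y = 1.
Proof.
move=> s0; rewrite (semigroupE hT hX)//; first exact: Rintegral_probability_cst.
exact: bounded_measurable_cst.
Qed.

Lemma evolution1 t1 t2 : 0 <= t1 <= t2 -> U t1 t2 (fun=> 1) =1 (fun=> 1).
Proof.
move=> t12 y; rewrite evolutionE//; last exact: bounded_measurable_cst.
transitivity (\int[pi t1 t2]_s (1 : R)); last exact: Rintegral_probability_cst.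
apply: eq_Rintegral => s _; apply: semigroup1; exact: vle0_pospart.
Qed.

Lemma evolution_ge0 t1 t2 f y : 0 <= t1 <= t2 -> bounded_borel f ->
  (forall x, 0 <= f x) -> 0 <= U t1 t2 f y.
Proof.
move=> t12 bf f0; rewrite evolutionE//; apply: Rintegral_ge0 => s _.
rewrite /Phi (semigroupE hT hX)//; last exact: vle0_pospart.
by apply: Rintegral_ge0.
Qed.

(** By the semigroup law both sides are the mean of [T] at the sum of two consecutive increments;
    independence lets these be drawn separately or from one path. *)
Lemma evolution_comp t1 t2 t3 f : 0 <= t1 -> t1 <= t2 -> t2 <= t3 ->
  bounded_borel f -> U t1 t2 (U t2 t3 f) =1 U t1 t3 f.
Proof.
move=> t10 t12 t23 bf y.
have t12' : 0 <= t1 <= t2 by rewrite t10.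
have t23' : 0 <= t2 <= t3 by rewrite (le_trans t10).
have t13' : 0 <= t1 <= t3 by rewrite t10 (le_trans t12).
have bU := bounded_borel_evolution t23' bf.
pose D w := S t2 w - S t1 w; pose D' w := S t3 w - S t2 w.
have mD := measurable_subordinator_increment (x := 0) t12'.
have mD' := measurable_subordinator_increment (x := 0) t23'.
(* The positive parts are taken before the sum, so that the semigroup law holds at every pair; the
   difference from the increment over both intervals is a null set. *)
pose H (z : 'rV[R]_k * 'rV[R]_k) := Phi f (pospart z.1 + pospart z.2) y.
have bH : bounded_measurable H.
  apply: (bounded_measurable_comp (g := fun z => pospart z.1 + pospart z.2)
    (bounded_measurable_slice y bf)).
  by apply: measurable_rVD; apply: measurableT_comp => //;
    exact: measurable_pospart.
transitivity (\int[P 0]_w \int[P 0]_v H (D w, D' v)).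
  rewrite (evolution_incrementE 0)//; apply: eq_Rintegral => w _.
  have p0 := vle0_pospart (D w).
  rewrite /Phi (semigroupE hT hX)//.
  (* Writing [T (pospart (D w))] as an expectation under [P y] lets Fubini's theorem move it inside
     the integral over the second increment. *)
  transitivity (\int[P y]_u \int[P 0]_v Phi f (D' v) (X (pospart (D w)) u)).
    by apply: eq_Rintegral => u _; exact: evolution_incrementE.
  rewrite (@bounded_Fubini _ _ _ _ _
    (fun z : g_sigma_algebraType (A y) * g_sigma_algebraType (A 0) =>
      Phi f (D' z.2) (X (pospart (D w)) z.1))); last first.
    apply: (bounded_measurable_comp
      (g := fun z : g_sigma_algebraType (A y) * g_sigma_algebraType (A 0) =>
        (D' z.2, X (pospart (D w)) z.1))
      (bounded_measurable_semigroup hT hTc hX bf)).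
    apply: measurable_fun_pair; first exact: measurableT_comp.
    apply: measurableT_comp => //; exact: (measurable_process hX).
  apply: eq_Rintegral => v _; have p0' := vle0_pospart (D' v).
  rewrite /H /Phi /=.
  rewrite (pospart_id (vle0D p0 p0')).
  have [_ _ ->//] := hT.
  by rewrite (semigroupE hT hX _ p0)//; exact: (bounded_borel_semigroup hT).
rewrite -(Rintegral_independent (P := P 0) mD mD' _ bH); last first.
  move=> B C mB mC; have [aS _ _] := hS 0.
  apply: (independent_of_past aS) => //; first exact: le_trans t12.
  have mB' : measurable_fun setT
      (D : g_sigma_algebraType (generators_of [set u | 0 <= u <= t2] S) -> _).
    by apply: measurable_rVB; apply: measurable_generators_of => /=;
      rewrite ?lexx ?t10 ?t12 ?(le_trans t10).
  by have := mB' measurableT B mB; rewrite setTI.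
rewrite (evolution_incrementE 0)//; apply: ae_eq_Rintegral => //.
- by apply: measurableT_comp; [case: bH|exact: measurable_fun_pair].
- apply: (measurableT_comp (bounded_measurable_slice y bf).1).
  exact: measurable_subordinator_increment.
- have [_ _ mono] := hS 0; apply: filterS mono => w mono.
  have t20 : 0 <= t2 by exact: le_trans t12.
  have vleB (u v : 'rV[R]_k) : vle u v -> vle 0 (v - u).
    by move=> uv j; rewrite !mxE subr_ge0.
  rewrite /H /= !pospart_id; [|exact/vleB/mono..].
  by rewrite /D /D' addrC subrKA.
Qed.

Lemma Markov_evolution_subordinated : Markov_evolution U.
Proof.
split=> [t1 t2 t12|]; last split=> [t f t0 bf|]; last split; last split;
  last split.
- split=> [f bf|a f g bf bg y]; first exact: bounded_borel_evolution.
  exact: evolution_linear.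
- exact: evolution_diag.
- by move=> *; exact: evolution_comp.
- by move=> t1 t2 f t12 bf f0 x; exact: evolution_ge0.
- move=> t1 t2 f t12 bf; apply: sup_norm_le => x.
  apply: evolution_norm_le => // y; apply: le_sup_norm.
  by case: bf.
- by move=> t1 t2; exact: evolution1.
Qed.

End evolution.

(** * Transition kernels *)

Section kernel_of_probabilities.
Context {R : realType} {d1 d2 : measure_display}.
Context {T1 : measurableType d1} {T2 : measurableType d2}.
Variable m : T1 -> probability T2 R.

(** The measurability proof is an argument so that the kernel structure can be attached to the
    resulting term. *)
Definition kernel_of
    (mm : forall B, measurable B -> measurable_fun setT (m ^~ B)) :
  T1 -> {measure set T2 -> \bar R} := m.

Hypothesis mm : forall B, measurable B -> measurable_fun setT (m ^~ B).

HB.instance Definition _ := @isKernel.Build _ _ T1 T2 R (kernel_of mm) mm.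

Let kernel_of_prob x : kernel_of mm x setT = 1%E.
Proof. exact: probability_setT. Qed.

HB.instance Definition _ :=
  @Kernel_isProbability.Build _ _ T1 T2 R (kernel_of mm) kernel_of_prob.

End kernel_of_probabilities.

Section kcomp_probability.
Context {R : realType} {d1 d2 d3 : measure_display}.
Context {T1 : measurableType d1} {T2 : measurableType d2}.
Context {T3 : measurableType d3}.
Variables (l : R.-pker T1 ~> T2) (k : R.-pker (T1 * T2) ~> T3).

Let kcomp_prob x : (l \; k)%E x setT = 1%E.
Proof.
rewrite /mkcomp /= /kcomp (eq_integral (cst 1%E)); last first.
  by move=> y _; exact: prob_kernel.
by rewrite integral_cst// mul1e prob_kernel.
Qed.

HB.instance Definition _ :=
  @Kernel_isProbability.Build _ _ T1 T3 R (l \; k)%E kcomp_prob.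

End kcomp_probability.

Section evolution_kernel.
Context {R : realType} {k d : nat} {Omega : pointedType}.
Variable A : 'rV[R]_d -> set (set Omega).
Variable P : forall x : 'rV[R]_d, probability (g_sigma_algebraType (A x)) R.
Variable S : R -> Omega -> 'rV[R]_k.
Variable pi : R -> R -> probability 'rV[R]_k R.
Variable X : 'rV[R]_k -> Omega -> 'rV[R]_d.
Variable T : 'rV[R]_k -> ('rV[R]_d -> R) -> 'rV[R]_d -> R.
Hypothesis hS : forall x, additive_subordinator (P x) S.
Hypothesis hpi : forall x (t1 t2 : R) (B : set 'rV[R]_k),
  0 <= t1 <= t2 -> measurable B ->
  pi t1 t2 B = P x [set w | B (S t2 w - S t1 w)].
Hypothesis hT : multiparameter_semigroup T.
Hypothesis hTc : strongly_continuous T.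
Hypothesis hX : homogeneous_Markov_process P X T.

Let U := subordinated_evolution T pi.
Let p := subordinated_kernel (law_from P X) pi.

Lemma law_fromE s x B : vle 0 s -> measurable B ->
  law_from P X s x B = (T s \1_B x)%:E.
Proof.
move=> s0 mB.
rewrite (semigroupE hT hX)//; last exact: bounded_measurable_indic.
rewrite EFin_Rintegral//; last first.
  apply: (bounded_measurable_comp (bounded_measurable_indic mB)).
  exact: (measurable_process hX).
have mX : measurable (X s @^-1` B : set (g_sigma_algebraType (A x))).
  rewrite -[X in measurable X]setTI.
  exact: (measurable_process hX s0 measurableT mB).
transitivity (P x (X s @^-1` B `&` setT)); first by rewrite setIT.
by rewrite -(integral_indic _ _ mX).
Qed.

Lemma subordinated_kernelE t1 t2 x B : 0 <= t1 <= t2 -> measurable B ->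
  p t1 t2 x B = (U t1 t2 \1_B x)%:E.
Proof.
move=> t12 mB; have bB := bounded_measurable_indic (R := R) mB.
have bPhi := bounded_measurable_slice hT hTc hX x bB.
have mO := @measurable_orthant R k.
transitivity (\int[pi t1 t2]_(s in orthant) (T (pospart s) \1_B x)%:E)%E.
  apply: eq_integral => s; rewrite inE => os.
  by rewrite law_fromE// pospart_id.
rewrite -EFin_Rintegral//; congr EFin.
by apply: eq_Rintegral => s; rewrite inE => os; rewrite pospart_id.
Qed.

Let kernel_law (z : 'rV[R]_d * 'rV[R]_k) : probability 'rV[R]_d R :=
  distribution (P z.1)
    (mfun_Sub (mem_set (measurable_process hX (x := z.1) (vle0_pospart z.2)))).

Let measurable_kernel_law B : measurable B ->
  measurable_fun setT (kernel_law ^~ B).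
Proof.
move=> mB; rewrite (_ : kernel_law ^~ B =
    EFin \o (fun z => T (pospart z.2) \1_B z.1)).
  apply/measurable_EFinP; have bB := bounded_measurable_indic (R := R) mB.
  apply: (measurableT_comp (bounded_measurable_semigroup hT hTc hX bB).1
    (g := fun z => (z.2, z.1))).
  exact: measurable_fun_pair.
by apply/funext => z /=; rewrite -law_fromE//; exact: vle0_pospart.
Qed.

(** The kernel is a composition: draw [s] from the constant kernel [pi t1 t2], then a point from the
    law of [X (pospart s)] under [P x]. *)
Lemma evolution_kernel_subordinated : evolution_kernel U p.
Proof.
move=> t1 t2 t12.
have mc (B : set 'rV[R]_k) : measurable B ->
  measurable_fun setT ((fun _ : 'rV[R]_d => pi t1 t2) ^~ B).
  by move=> mB; exact: measurable_cst.
pose l : R.-pker 'rV[R]_d ~> 'rV[R]_k := kernel_of mc.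
pose q : R.-pker ('rV[R]_d * 'rV[R]_k) ~> 'rV[R]_d :=
  kernel_of measurable_kernel_law.
pose K : R.-pker 'rV[R]_d ~> 'rV[R]_d := (l \; q)%E.
exists K; split.
  move=> x B mB; rewrite subordinated_kernelE//.
  have bB := bounded_measurable_indic (R := R) mB.
  rewrite /U (evolutionE hS hpi hT hTc hX)//.
  rewrite EFin_Rintegral//; last exact: (bounded_measurable_slice hT hTc hX).
  apply: eq_integral => s _; rewrite -law_fromE//; exact: vle0_pospart.
move=> f x bf; have [mf /bounded_fun_leP[M hM]] := bf.
(* Integration against a composed kernel is available for nonnegative functions; [f] is shifted by
   its bound, and the shift is removed by linearity, whose shape explains the factor 1. *)
pose g y := 1 * f y + M.
have bM : bounded_borel (fun _ : 'rV[R]_d => M) 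
  by exact: bounded_measurable_cst.
have bg : bounded_borel g.
  by apply: bounded_measurableD => //; apply: bounded_measurableM => //;
    exact: bounded_measurable_cst.
have g0 y : 0 <= g y.
  rewrite /g mul1r -lerBlDr sub0r; have := hM y.
  by rewrite ler_norml => /andP[].
have UK h : bounded_borel h -> (forall y, 0 <= h y) ->
    U t1 t2 h x = \int[K x]_y h y.
  move=> bh h0; rewrite /U (evolutionE hS hpi hT hTc hX)//; congr fine.
  rewrite (integral_kcomp l q x (f := EFin \o h))//; last first.
  - by apply/measurable_EFinP; case: bh.
  apply: eq_integral => s _.
  rewrite (semigroupE hT hX)//; last exact: vle0_pospart.
  rewrite -(Rintegral_distribution (P x)
    (mfun_Sub (mem_set (measurable_process hX (vle0_pospart s)))) bh).
  by rewrite EFin_Rintegral.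
have Kint (h : 'rV[R]_d -> R) : bounded_borel h ->
    (K x).-integrable setT (EFin \o h).
  move=> [mh bdh]; apply: measurable_bounded_integrable => //.
  by rewrite prob_kernel ltry.
have M0 : 0 <= M by exact: le_trans (hM 0).
have := evolution_linear hS hpi hT hTc hX 1 x t12 bf bM.
rewrite -/U (UK g)// (UK (fun=> M))// mul1r.
have -> : \int[K x]_y g y = \int[K x]_y f y + \int[K x]_y M.
  rewrite -RintegralD//; [|exact: Kint|exact: Kint].
  by apply: eq_Rintegral => y _; rewrite /g mul1r.
by move/addIr.
Qed.

End evolution_kernel.

(** * The Markov property *)

(** [N] belongs to [F] because its complement is negligible; so [C] is the union of [B] cut by [N]
    and a negligible set. *)
Lemma sigma_algebra_ae_trace {d : measure_display} {T : measurableType d}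
    {R : realType} (P : probability T R) (F : set (set T)) (B C N : set T) :
  sigma_algebra setT F -> P.-negligible `<=` F -> P.-negligible (~` N) ->
  B `&` N = C `&` N -> F B -> F C.
Proof.
move=> sF Fc nN e FB.
have /sigma_algebraP[//|_ FD _ FI] := sF.
have [_ FC FU] := sF.
have FcN : F (C `&` ~` N).
  by apply: Fc; apply: negligibleS nN; exact: subIsetr.
have FN : F N by rewrite -(setCK N) -setTD; apply: FC; exact: Fc.
rewrite -(setUIDK C N) setDE -bigcup2E; apply: FU => -[|[|n]] //=.
  by rewrite -e; exact: FI.
by have [] := sF.
Qed.

Section Markov_property.
Context {R : realType} {k d : nat} {Omega : pointedType}.
Variable A : 'rV[R]_d -> set (set Omega).
Variable P : forall x : 'rV[R]_d, probability (g_sigma_algebraType (A x)) R.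
Variable S : R -> Omega -> 'rV[R]_k.
Variable pi : R -> R -> probability 'rV[R]_k R.
Variable X : 'rV[R]_k -> Omega -> 'rV[R]_d.
Variable T : 'rV[R]_k -> ('rV[R]_d -> R) -> 'rV[R]_d -> R.
Hypothesis hS : forall x, additive_subordinator (P x) S.
Hypothesis hpi : forall x (t1 t2 : R) (B : set 'rV[R]_k),
  0 <= t1 <= t2 -> measurable B ->
  pi t1 t2 B = P x [set w | B (S t2 w - S t1 w)].
Hypothesis hT : multiparameter_semigroup T.
Hypothesis hTc : strongly_continuous T.
Hypothesis hX : homogeneous_Markov_process P X T.
Hypothesis hXS : forall x,
  independent_processes (P x) orthant X [set t : R | 0 <= t] S.

Let U := subordinated_evolution T pi.
Let Y := subordinated_process X S.
Let Phi (f : 'rV[R]_d -> R) (s : 'rV[R]_k) (y : 'rV[R]_d) := T (pospart s) f y.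

Variable x : 'rV[R]_d.

Local Notation Om := (g_sigma_algebraType (A x)).
Let Xt : 'rV[R]_k * Omega -> 'rV[R]_d := joint_version X.
Let cadlag_paths : set Om := [set w | cadlag_vle (X ^~ w)].

Let cadlag_paths_ae : {ae P x, forall w, cadlag_paths w}.
Proof. by have [F /(_ x) [_ [_ [cX _]]]] := hX. Qed.

Let orthant_S t w : 0 <= t -> vle 0 (S t w).
Proof. by have [_ S0 _] := hS x; exact: S0. Qed.

Let subordinated_processE t w :
  0 <= t -> cadlag_paths w -> Y t w = Xt (S t w, w).
Proof.
move=> t0 cw; rewrite /Xt joint_versionE//.
by rewrite pospart_id; last exact: orthant_S.
Qed.

Let measurable_Xt : measurable_fun setT (Xt : 'rV[R]_k * Om -> 'rV[R]_d).
Proof.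
by apply: measurable_joint_version => s; exact: (measurable_process hX).
Qed.

(** On cadlag paths [Y t] is the joint version evaluated at [(S t w, w)]. The ambient sigma-algebra
    is complete because it contains the complete [F x 0], so the other paths do no harm. *)
Lemma measurable_subordinated_process t : 0 <= t ->
  measurable_fun setT (Y t : Om -> 'rV[R]_d).
Proof.
move=> t0 _ B mB; rewrite setTI.
have [F /(_ x) [[hF _] [_ [_ [Fc _]]]]] := hX.
have v0 : vle 0 (0 : 'rV[R]_k) by move=> j.
have [_ Fm] := hF _ v0.
apply: (@sigma_algebra_ae_trace _ Om _ (P x) measurable
  ((fun w => Xt (S t w, w)) @^-1` B) _ cadlag_paths).
- exact: sigma_algebra_measurable.
- by move=> N /(Fc _ v0) /Fm.
- exact: cadlag_paths_ae.
- by apply/seteqP; split=> w [Bw cw]; split=> //; move: Bw;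
    rewrite /preimage /= subordinated_processE.
- rewrite -[X in measurable X]setTI.
  have mS := measurable_subordinator hS (x := x) t0.
  have : measurable_fun setT (fun w : Om => Xt (S t w, w)).
    by apply: measurableT_comp => //; exact: measurable_fun_pair.
  by apply.
Qed.

Variables (t1 t2 : R).
Hypothesis t12 : 0 <= t1 <= t2.

Let t10 : 0 <= t1. Proof. by case/andP: t12. Qed.
Let t20 : 0 <= t2. Proof. by have /andP[_] := t12; exact: le_trans. Qed.

Local Notation OmX := (g_sigma_algebraType (generators_of orthant X)).
Local Notation OmS :=
  (g_sigma_algebraType (generators_of [set u : R | 0 <= u <= t1] S)).
Let D w := S t2 w - S t1 w.
(** It also records the increment up to [t2]: all the information on [S] that enters the Markov
    property, independent of [X] as a whole. *)
Let past (w : Om) : OmS * 'rV[R]_k := (w, D w).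

Let measurable_XtX : measurable_fun setT (Xt : 'rV[R]_k * OmX -> 'rV[R]_d).
Proof.
by apply: measurable_joint_version => s s0; exact: measurable_generators_of.
Qed.

Let measurable_S1 : measurable_fun setT (S t1 : OmS -> 'rV[R]_k).
Proof. by apply: measurable_generators_of => /=; rewrite t10 lexx. Qed.

Let measurable_idX : measurable_fun setT (id : Om -> OmX).
Proof.
move=> _ B mB; rewrite setTI.
apply: (@measurable_sigma_of _ Om _ _ _ orthant X _ B mB) => s s0.
exact: (measurable_process hX).
Qed.

Let measurable_idS : measurable_fun setT (id : Om -> OmS).
Proof.
move=> _ B mB; rewrite setTI.
apply: (@measurable_sigma_of _ Om _ _ _ [set u | 0 <= u <= t1] S _ B mB).
move=> u /andP[u0 _].
exact: (measurable_subordinator hS).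
Qed.

Let measurable_D : measurable_fun setT (D : Om -> 'rV[R]_k).
Proof. exact: (measurable_subordinator_increment hS t12). Qed.

Let measurable_past : measurable_fun setT past.
Proof. exact: measurable_fun_pair. Qed.

Let independent_X_past (B : set OmX) (C : set (OmS * 'rV[R]_k)) :
  measurable B -> measurable C ->
  P x (id @^-1` B `&` past @^-1` C) = (P x (id @^-1` B) * P x (past @^-1` C))%E.
Proof.
move=> mB mC; apply: (hXS (x := x)) => //.
pose OmS' := g_sigma_algebraType (generators_of [set u : R | 0 <= u] S).
have mp : measurable_fun setT (past : OmS' -> OmS * 'rV[R]_k).
  apply: measurable_fun_pair.
    move=> _ E mE; rewrite setTI; apply: sigma_of_subset mE.
    by move=> u /= /andP[].
  by apply: measurable_rVB; exact: measurable_generators_of.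
by have := mp measurableT C mC; rewrite setTI.
Qed.

Let increasing_paths : set Om := [set w | forall s t : R, 0 <= s -> s <= t ->
  vle (S s w) (S t w)].

(* The sets [C] with the second property form a sigma-algebra of subsets of the
   product, so it suffices to treat the events [Y u @^-1` E]; completeness of
   the filtration absorbs the paths of [X] that are not cadlag. *)
Lemma past_event_section (F : 'rV[R]_k -> set (set Om)) (B : set Om) :
  filtration F -> (forall s, vle 0 s -> measurable_wrt (F s) (X s)) ->
  complete_filtration (P x) F ->
  sigma_of [set u : R | 0 <= u <= t1] Y B ->
  exists C : set (OmX * OmS), [/\ measurable C,
    forall v, increasing_paths v -> F (S t1 v) [set w | C (w, v)] &
    B `&` cadlag_paths = [set w | C (w, w)] `&` cadlag_paths].
Proof.
move=> [hF Fmono] Fad Fc.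
pose H := [set C : set (OmX * OmS) | measurable C /\
  forall v, increasing_paths v -> F (S t1 v) [set w | C (w, v)]].
have sH : sigma_algebra setT H.
  split.
  - split=> // v _; have [[F0 _ _] _] := hF _ (orthant_S v t10).
    by rewrite (_ : [set w | _] = set0)//; apply/seteqP; split.
  - move=> C [mC hC]; split; first exact: measurableD.
    move=> v /hC; have [[_ FC _] _] := hF _ (orthant_S v t10) => /FC.
    by rewrite setTD; congr (F _ _); apply/seteqP; split => w //= [].
  - move=> C hC; split; first by apply: bigcupT_measurable => n; case: (hC n).
    move=> v iv; have [[_ _ FU] _] := hF _ (orthant_S v t10).
    rewrite (_ : [set w | _] = \bigcup_n [set w | C n (w, v)]).
      by apply: FU => n; case: (hC n) => _; exact.
    by apply/seteqP; split.
move=> sB.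
have [] := @sigma_of_trace Om R _ _ _ _ Y (fun w => (w, w) : OmX * OmS)
   cadlag_paths H sH _ B sB; last first.
  by move=> C [mC hC] e; exists C.
move=> u E /= /andP[u0 ut1] mE.
(* The two roles of [w] are separated: the first component runs the process [X], the second supplies
   the time [S u]. *)
exists [set z : OmX * OmS | E (Xt (S u z.2, z.1))]; last first.
  by apply/seteqP; split=> w [Bw cw]; split=> //; move: Bw;
    rewrite /preimage /= subordinated_processE.
split.
  rewrite -[X in measurable X]setTI.
  have : measurable_fun setT (fun z : OmX * OmS => Xt (S u z.2, z.1)).
    apply: measurableT_comp => //; apply: measurable_fun_pair => //.
    apply: measurableT_comp => //; apply: measurable_generators_of => /=.
    by rewrite u0.
  by move=> /(_ measurableT E mE).
move=> v iv; have S0 := orthant_S v t10.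
have [sF _] := hF _ S0.
apply: (sigma_algebra_ae_trace (P := P x) (N := cadlag_paths)
  (B := X (S u v) @^-1` E)) => //.
- exact: Fc.
- apply/seteqP; split=> w [Bw cw]; split=> //; move: Bw;
    rewrite /preimage /= /Xt joint_versionE// pospart_id//; exact: orthant_S.
- have Su0 := orthant_S v u0.
  by apply: (Fmono (S u v)) => //; [exact: iv|exact: Fad].
Qed.

Let increasing_paths_ae : {ae P x, forall w, increasing_paths w}.
Proof. by have [_ _ mono] := hS x. Qed.

Let bounded_measurable_OmX (h : OmX * (OmS * 'rV[R]_k) -> R) :
  bounded_measurable h ->
  bounded_measurable (fun z : Om * Om => h (z.1, past z.2)).
Proof.
move=> bh; apply: (bounded_measurable_comp (g := fun z : Om * Om =>
  ((z.1, past z.2) : OmX * (OmS * 'rV[R]_k))) bh).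
apply: measurable_fun_pair.
  exact: (measurableT_comp measurable_idX measurable_fst).
exact: (measurableT_comp measurable_past measurable_snd).
Qed.

Let measurable_Rintegral_OmX (h : OmX * (OmS * 'rV[R]_k) -> R) :
  bounded_measurable h ->
  measurable_fun setT (fun v : Om => \int[P x]_w h (w, past v)).
Proof.
move=> bh.
have bsw : bounded_measurable (fun z : Om * Om => h (z.2, past z.1)).
  apply: (bounded_measurable_comp (g := fun z : Om * Om => (z.2, z.1))
    (bounded_measurable_OmX bh)).
  exact: measurable_fun_pair.
exact: (bounded_measurable_Rintegral bsw (P x)).1.
Qed.

Lemma Markov_integral (f : 'rV[R]_d -> R) (B : set Om) : bounded_borel f ->
  sigma_of [set u : R | 0 <= u <= t1] Y B ->
  \int[P x]_(w in B) f (Y t2 w) = \int[P x]_(w in B) U t1 t2 f (Y t1 w).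
Proof.
move=> bf sB; have [F /(_ x) [hF [Fad [_ [Fc [_ [hM _]]]]]]] := hX.
have [C [mC FC BC]] := past_event_section hF Fad Fc sB.
have mY1 := measurable_subordinated_process t10.
have mY2 := measurable_subordinated_process t20.
have bU := bounded_borel_evolution hS hpi hT hTc hX t12 bf.
have mB : measurable B.
  apply: (@measurable_sigma_of _ Om _ _ _ [set u | 0 <= u <= t1] Y _ B sB).
  by move=> u /andP[u0 _]; exact: measurable_subordinated_process.
pose C1 (z : OmX * (OmS * 'rV[R]_k)) : R := \1_C (z.1, z.2.1).
have bC1 : bounded_measurable C1.
  apply: (bounded_measurable_comp (g := fun z => (z.1, z.2.1))
    (bounded_measurable_indic mC)).
  by apply: measurable_fun_pair => //; exact: measurableT_comp.
have mX1 : measurable_fun setT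
    (fun z : OmX * (OmS * 'rV[R]_k) => Xt (S t1 z.2.1, z.1)).
  apply: measurableT_comp => //; apply: measurable_fun_pair => //.
  by apply: measurableT_comp => //; exact: measurableT_comp.
(* The integrand at three stages: the initial one, after the Markov property of [X], and after
   averaging over the increment of [S]. *)
pose H1 (z : OmX * (OmS * 'rV[R]_k)) := C1 z * f (Xt (S t1 z.2.1 + z.2.2, z.1)).
pose H2 (z : OmX * (OmS * 'rV[R]_k)) :=
  C1 z * Phi f z.2.2 (Xt (S t1 z.2.1, z.1)).
pose H3 (z : OmX * (OmS * 'rV[R]_k)) := C1 z * U t1 t2 f (Xt (S t1 z.2.1, z.1)).
have bH1 : bounded_measurable H1.
  apply: bounded_measurableM => //.
  apply: (bounded_measurable_comp (g := fun z : OmX * (OmS * 'rV[R]_k) =>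
    Xt (S t1 z.2.1 + z.2.2, z.1)) bf).
  apply: measurableT_comp => //; apply: measurable_fun_pair => //.
  apply: measurable_rVD; last exact: measurableT_comp.
  by apply: measurableT_comp => //; exact: measurableT_comp.
have bH2 : bounded_measurable H2.
  apply: bounded_measurableM => //.
  apply: (bounded_measurable_comp (g := fun z : OmX * (OmS * 'rV[R]_k) =>
    (z.2.2, Xt (S t1 z.2.1, z.1))) (bounded_measurable_semigroup hT hTc hX bf)).
  by apply: measurable_fun_pair => //; exact: measurableT_comp.
have bH3 : bounded_measurable H3.
  apply: bounded_measurableM => //.
  exact: (bounded_measurable_comp (g := fun z : OmX * (OmS * 'rV[R]_k) =>
    Xt (S t1 z.2.1, z.1)) bU).
have BCw w : cadlag_paths w -> \1_B w = \1_C (w, w) :> R.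
  move=> cw; rewrite !indicE; congr (_%:R); congr nat_of_bool.
  apply/idP/idP => /set_mem h; apply/mem_set.
    by have [] : ([set w | C (w, w)] `&` cadlag_paths) w by rewrite -BC.
  by have [] : (B `&` cadlag_paths) w by rewrite BC.
transitivity (\int[P x]_w H1 (w, past w)).
  rewrite Rintegral_indicM; apply: ae_eq_Rintegral => //.
  - by apply: measurable_funM => //; apply: measurableT_comp => //; case: bf.
  - exact: (measurableT_comp bH1.1
      (measurable_fun_pair measurable_idX measurable_past)).
  - apply: filterS cadlag_paths_ae => w cw.
    rewrite /H1 /C1 /= (_ : S t1 w + D w = S t2 w); last by rewrite addrC subrK.
    by rewrite BCw// subordinated_processE.
have indep_past (h : OmX * (OmS * 'rV[R]_k) -> R) : bounded_measurable h ->
    \int[P x]_w h (w, past w) = \int[P x]_w \int[P x]_v h (w, past v).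
  move=> bh.
  exact: (Rintegral_independent measurable_idX measurable_past
    independent_X_past bh).
have swap (h : OmX * (OmS * 'rV[R]_k) -> R) : bounded_measurable h ->
    \int[P x]_w \int[P x]_v h (w, past v) =
    \int[P x]_v \int[P x]_w h (w, past v).
  move=> bh; exact: (bounded_Fubini (bounded_measurable_OmX bh) (P x) (P x)).
rewrite (indep_past H1 bH1) (swap H1 bH1).
transitivity (\int[P x]_v \int[P x]_w H2 (w, past v)).
  apply: ae_eq_Rintegral.
  - exact: measurable_Rintegral_OmX.
  - exact: measurable_Rintegral_OmX.
  - apply: filterS increasing_paths_ae => v iv.
    have S0 := orthant_S v t10.
    have D0 : vle 0 (D v).
      by move=> j; rewrite !mxE subr_ge0; apply: iv => //; case/andP: t12.
    pose Cv := [set w : Om | C (w, v)].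
    have [sF Fm] := hF.1 _ S0.
    have mCv : measurable Cv by apply: Fm; exact: FC.
    have C1E w : C1 (w, past v) = \1_Cv w.
      by rewrite /C1 /= !indicE.
    (* With [v] frozen the times [S t1 v] and [D v] are deterministic, and the section of [C] is an
       admissible event at time [S t1 v]. *)
    have [_ _ /(_ _ (FC v iv)) /(congr1 fine) E] := hM _ _ _ S0 D0 bf.
    transitivity (\int[P x]_(w in Cv) f (X (S t1 v + D v) w)).
      rewrite [RHS]Rintegral_indicM; apply: ae_eq_Rintegral.
      + exact: (measurableT_comp (bounded_measurable_pair2 bH1 (past v)).1
          measurable_idX).
      + apply: measurable_funM; first exact: measurable_indic.
        apply: measurableT_comp; first by case: bf.
        by apply: (measurable_process hX); exact: vle0D.
      + apply: filterS cadlag_paths_ae => w cw.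
        by rewrite /H1 C1E /= /Xt joint_versionE// pospart_id//; exact: vle0D.
    rewrite -[LHS]E; change (\int[P x]_(w in Cv) T (D v) f (X (S t1 v) w) =
      \int[P x]_w H2 (w, past v)).
    rewrite [LHS]Rintegral_indicM; apply: ae_eq_Rintegral.
    + apply: measurable_funM; first exact: measurable_indic.
      apply: measurableT_comp.
        by case: (bounded_borel_semigroup hT D0 bf).
      exact: (measurable_process hX).
    + exact: (measurableT_comp (bounded_measurable_pair2 bH2 (past v)).1
        measurable_idX).
    + apply: filterS cadlag_paths_ae => w cw.
      by rewrite /H2 C1E /= /Xt joint_versionE// /Phi !pospart_id.
rewrite -(swap H2 bH2).
transitivity (\int[P x]_w \int[P x]_v H3 (w, past v)).
  apply: eq_Rintegral => w _.
  have bH2w := bounded_measurable_pair1 bH2 w.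
  (* Now the path of [X] is frozen instead. The increment is independent of the past of [S], so it
     receives its own copy of the sample point and integrates to [U t1 t2 f]. *)
  rewrite (@Rintegral_independent _ _ _ _ Om OmS _ (P x) id D measurable_idS
    measurable_D _ (fun z => H2 (w, z)))//; last first.
    move=> B' C' mB' mC'; have [aS _ _] := hS x.
    by apply: (independent_of_past aS) => //; case/andP: t12.
  apply: eq_Rintegral => v _.
  rewrite /H2 /H3 /C1 /= RintegralZl//.
    by rewrite /U (evolution_incrementE hS hpi hT hTc hX x).
    apply: (@bounded_measurable_integrable _ _ _ _
    (fun v' : Om => Phi f (D v') (Xt (S t1 v, w)))) => //.
  apply: (bounded_measurable_comp
    (bounded_measurable_slice hT hTc hX (Xt (S t1 v, w)) bf)).
  exact: measurable_D.
(* Independence is read backwards to return to the diagonal. *)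
rewrite -(indep_past H3 bH3) [RHS]Rintegral_indicM.
apply: ae_eq_Rintegral => //.
- exact: (measurableT_comp bH3.1
    (measurable_fun_pair measurable_idX measurable_past)).
- by apply: measurable_funM => //; apply: measurableT_comp => //; case: bU.
- apply: filterS cadlag_paths_ae => w cw.
  by rewrite /H3 /C1 /= BCw// subordinated_processE.
Qed.

End Markov_property.

Theorem theorem3p1 (R : realType) (k d : nat) (Omega : pointedType)
  (A : 'rV[R]_d -> set (set Omega))
  (P : forall x : 'rV[R]_d, probability (g_sigma_algebraType (A x)) R)
  (S : R -> Omega -> 'rV[R]_k)
  (pi : R -> R -> probability 'rV[R]_k R)
  (X : 'rV[R]_k -> Omega -> 'rV[R]_d)
  (T : 'rV[R]_k -> ('rV[R]_d -> R) -> 'rV[R]_d -> R)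
  (hS : forall x, additive_subordinator (P x) S)
  (hpi : forall x (t1 t2 : R) (B : set 'rV[R]_k),
     0 <= t1 <= t2 -> measurable B ->
     pi t1 t2 B = P x [set w | B (S t2 w - S t1 w)])
  (hT : multiparameter_semigroup T)
  (hTc : strongly_continuous T)
  (hX : homogeneous_Markov_process P X T)
  (hXS : forall x,
     independent_processes (P x) orthant X [set t : R | 0 <= t] S) :
  let U := subordinated_evolution T pi in
  let p := subordinated_kernel (law_from P X) pi in
  let Y := subordinated_process X S in
  Markov_evolution U /\
  normal_evolution U /\
  evolution_kernel U p /\
  (forall x, [/\ Markov_process (P x) Y,
                 associated_evolution (P x) Y U &
                 transition_probabilities (P x) Y p]).
Proof.
move=> U p Y.
(* Leaving [D] free between the present and the whole past shows that one variable is a version of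
   both conditional expectations, which is the Markov property. *)
have condexp x (t1 t2 : R) f (D : set R) : 0 <= t1 <= t2 -> bounded_borel f ->
    D t1 -> D `<=` [set u : R | 0 <= u <= t1] ->
    is_condexp (P x) (sigma_of D Y) (f \o Y t2) (U t1 t2 f \o Y t1).
  move=> t12 bf Dt1 Dsub; have /andP[t10 tt] := t12.
  have t20 := le_trans t10 tt.
  have mY t : 0 <= t -> measurable_fun setT
      (Y t : g_sigma_algebraType (A x) -> 'rV[R]_d).
    exact: (measurable_subordinated_process hS hX).
  have bU : bounded_borel (U t1 t2 f).
    exact: (bounded_borel_evolution hS hpi hT hTc hX).
  have bUY := bounded_measurable_comp bU (mY _ t10).
  have bfY := bounded_measurable_comp bf (mY _ t20).
  split=> [B mB||B sB].
  - rewrite (_ : _ @^-1` B = Y t1 @^-1` (U t1 t2 f @^-1` B))//.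
    apply: sigma_of_preimage => //.
    by rewrite -[X in measurable X]setTI; apply: bU.1.
  - exact: bounded_measurable_integrable bUY.
  - have sB' : sigma_of [set u : R | 0 <= u <= t1] Y B.
      exact: sigma_of_subset sB.
    have mB : measurable (B : set (g_sigma_algebraType (A x))).
      apply: (@measurable_sigma_of _ (g_sigma_algebraType (A x)) _ _ _
        [set u | 0 <= u <= t1] Y _ B sB').
      by move=> u /andP[u0 _]; exact: mY.
    rewrite -EFin_Rintegral// -[RHS]EFin_Rintegral//; congr EFin.
    exact/esym/(Markov_integral hS hpi hT hTc hX hXS t12 bf sB').
split; first exact: (Markov_evolution_subordinated hS hpi hT hTc hX).
split; first exact: (bounded_borel_evolution hS hpi hT hTc hX).
split; first exact: (evolution_kernel_subordinated hS hpi hT hTc hX).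
move=> x.
have associated : associated_evolution (P x) Y U.
  move=> t1 t2 f t12 bf; apply: condexp => //.
  by move=> _ ->; have /andP[t10 _] := t12; rewrite /= t10 lexx.
split=> //.
  split=> [t t0|t1 t2 f t12 bf].
    exact: (measurable_subordinated_process hS hX).
  exists (U t1 t2 f \o Y t1), (U t1 t2 f \o Y t1); split.
  - by apply: condexp => //=; have /andP[-> _] := t12; rewrite lexx.
  - exact: associated.
  - exact: ae_eq_refl.
move=> t1 t2 B t12 mB.
rewrite (_ : (fun w => _) = U t1 t2 \1_B \o Y t1).
  by apply: associated => //; exact: bounded_measurable_indic.
apply/funext => w.
by rewrite /p (subordinated_kernelE pi hT hTc hX).
Qed.
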